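(* Suppose $n$ is an odd integer with $t_2+t_3\leq n<t_1$, and put $K=k_1+k_2+k_3$, $N=\tfrac{n+1}{2}$. Then: (i) the $\mathfrak{BI}$-module $\mathscr M_n(x_2)\cap\mathscr M_n(x_3)$ is isomorphic to $W_1\oplus W_1$, where $W_1=E_{n-t_2-t_3}(k_1+k_3+N,\,-k_1-k_2-N,\,N)^{((-1,-1),(1\,3))}$; (ii) the $\mathfrak{BI}$-modules $\mathscr M_n(x_3)/(\mathscr M_n(x_2)\cap\mathscr M_n(x_3))$ and $\mathscr M_n/\mathscr M_n(x_2)$ are each isomorphic to $W_2\oplus W_2$, where $W_2=O_{t_2-1}(k_1,\,-K-n-1,\,k_3)^{(1\,3)}$; (iii) the $\mathfrak{BI}$-modules $\mathscr M_n(x_2)/(\mathscr M_n(x_2)\cap\mathscr M_n(x_3))$ and $\mathscr M_n/\mathscr M_n(x_3)$ are each isomorphic to $W_3\oplus W_3$, where $W_3=O_{t_3-1}(k_1,\,-K-n-1,\,k_2)^{(1\,3\,2)}$. Moreover, if $k_1\geq0$, then $W_1,W_2,W_3$ are irreducible and are isomorphic to $E_{n-t_2-t_3}(N,\,k_1+k_2+N,\,k_1+k_3+N)^{(1,-1)}$, $O_{t_2-1}(k_3,\,-K-n-1,\,k_1)$ and $O_{t_3-1}(k_2,\,k_1,\,-K-n-1)$, respectively.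
   Context: Fix real numbers $k_1,k_2,k_3$. For $i=1,2,3$ let $R_i$ be the operator on functions on $\mathbb R^3$ replacing $x_i$ by $-x_i$, and $T_if=\frac{\partial f}{\partial x_i}+k_i\frac{f-R_if}{x_i}$ (Dunkl operators). Let $\sigma_1=\begin{pmatrix}0&1\\1&0\end{pmatrix}$, $\sigma_2=\begin{pmatrix}0&-\sqrt{-1}\\ \sqrt{-1}&0\end{pmatrix}$, $\sigma_3=\begin{pmatrix}1&0\\0&-1\end{pmatrix}$, and let $e_i$ act on $\mathbb C^2$ by $\sigma_i$. Tensor products are over $\mathbb R$; $\mathbb R[\cdots]_m$ denotes homogeneous polynomials of degree $m$. Let $\mathbf D=e_1\otimes T_1+e_2\otimes T_2+e_3\otimes T_3$ and $\mathscr M_n=\ker(\mathbf D|_{\mathbb C^2\otimes\mathbb R[x_1,x_2,x_3]_n})$. For $i=1,2,3$ set $t_i=-2k_i$ if $2k_i$ is an odd negative integer, and $t_i=\infty$ otherwise. For $i=1,2,3$, $\mathscr M_n(x_i)=\mathscr M_n\cap\bigoplus_{j=t_i}^n\mathbb C^2\otimes(x_i^j\cdot\mathbb R[x_p,x_q]_{n-j})$ where $\{p,q\}=\{1,2,3\}\setminus\{i\}$ (it is $\{0\}$ if $n<t_i$); it is a $\mathfrak{BI}$-submodule of $\mathscr M_n$. $\mathfrak{BI}$ is the unital associative $\mathbb C$-algebra generated by $X,Y,Z$ with relations saying that $\{X,Y\}-Z$, $\{Y,Z\}-X$, $\{Z,X\}-Y$ commute with $X,Y,Z$ ($\{A,B\}=AB+BA$).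 $\mathscr M_n$ is a $\mathfrak{BI}$-module via $X=(\sqrt{-1}\,e_1\otimes(x_3T_2-x_2T_3)+\tfrac12)R_2R_3+k_2R_3+k_3R_2$, $Y=(\sqrt{-1}\,e_2\otimes(x_1T_3-x_3T_1)+\tfrac12)R_1R_3+k_3R_1+k_1R_3$, $Z=(\sqrt{-1}\,e_3\otimes(x_2T_1-x_1T_2)+\tfrac12)R_1R_2+k_1R_2+k_2R_1$, operators composed right to left, $R_i$ acting on the polynomial factor. Twisting: for a $\mathfrak{BI}$-module $V$ and algebra automorphism $\varepsilon$, $V^\varepsilon$ is $V$ with action $x\cdot v=\varepsilon(x)v$. A permutation $\sigma\in\mathfrak S_3$ denotes the automorphism sending the generator with index $i$ in $(X,Y,Z)$ to the generator with index $\sigma(i)$; the sign automorphisms are $(1,-1)\colon X\mapsto X,Y\mapsto -Y,Z\mapsto -Z$; $(-1,1)\colon X\mapsto -X,Y\mapsto Y,Z\mapsto -Z$; $(-1,-1)\colon X\mapsto -X,Y\mapsto -Y,Z\mapsto Z$; a pair $(\epsilon,\sigma)$ denotes the composite $\epsilon\circ\sigma$. For $a,b,c\in\mathbb C$ and an integer $d\geq0$, let $\theta_i=\frac{(-1)^i(2a-d+2i)}{2}$, $\theta^*_i=\frac{(-1)^i(2b-d+2i)}{2}$ ($0\le i\le d$). For odd $d$, $E_d(a,b,c)$ is the $\mathfrak{BI}$-module $\mathbb C^{d+1}$ in which, w.r.t. a basis $v_0,\dots,v_d$, $X$ acts by the lower bidiagonal matrix with diagonal $(\theta_i)$ and subdiagonal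 entries $1$, $Y$ by the upper bidiagonal matrix with diagonal $(\theta^*_i)$ and superdiagonal $(\varphi_1,\dots,\varphi_d)$ with $\varphi_i=i(d-i+1)$ ($i$ even), $\varphi_i=c^2-\frac{(2a+2b-d+2i-1)^2}{4}$ ($i$ odd), and $Z=\{X,Y\}-\big(c^2-a^2-b^2+\frac{(d+1)^2}{4}\big)$. For even $d$, $O_d(a,b,c)$ is defined in the same way but with $\varphi_i=\frac{i(d+1-2i-2a-2b-2c)}{2}$ ($i$ even), $\varphi_i=\frac{(i-d-1)(d+1-2i-2a-2b+2c)}{2}$ ($i$ odd), and $Z=\{X,Y\}-(2ab-c(d+1))$. *)

(* Defs.v *)
From HB Require Import structures.
From mathcomp Require Import all_boot all_order all_algebra.
From mathcomp Require Import mpoly.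
Set Implicit Arguments. Unset Strict Implicit. Unset Printing Implicit Defensive.
Import GRing.Theory Num.Theory.
Local Open Scope ring_scope.

(* Indices: the variable x_1, x_2, x_3 are 'X_i1, 'X_i2, 'X_i3 with the
   ordinals 0,1,2 of 'I_3; generators X, Y, Z of BI have indices i1, i2, i3. *)
Definition i1 : 'I_3 := @Ordinal 3 0 isT.
Definition i2 : 'I_3 := @Ordinal 3 1 isT.
Definition i3 : 'I_3 := @Ordinal 3 2 isT.

Section Dunkl.
Variable C : numClosedFieldType.
(* C^2 (x)_R R[x1,x2,x3] = pairs of polynomials with complex coefficients *)
Local Notation P := {mpoly C[3]}.
Local Notation V := (P * P)%type.

Definition refl (i : 'I_3) (f : P) : P :=
  f \mPo [tuple (if j == i then - 'X_j else 'X_j) | j < 3].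

(* exact quotient by x_i of the part of f divisible by x_i; for f divisible by
   x_i (as f - R_i f is) this is f / x_i *)
Definition divX (i : 'I_3) (f : P) : P :=
  \sum_(m <- msupp f | (0 < m i)%N) f@_m *: 'X_[m - U_(i)].

Definition dunkl (k : 'I_3 -> C) (i : 'I_3) (f : P) : P :=
  f^`M(i) + k i *: divX i (f - refl i f).

Definition kfun (k1 k2 k3 : C) (i : 'I_3) : C :=
  if i == i1 then k1 else if i == i2 then k2 else k3.

Definition vmap (F : P -> P) (v : V) : V := (F v.1, F v.2).

(* Pauli matrices acting on C^2 *)
Definition sig (i : 'I_3) (v : V) : V :=
  if i == i1 then (v.2, v.1)
  else if i == i2 then (- 'i *: v.2, 'i *: v.1)
  else (v.1, - v.2).

Variables k1 k2 k3 : C.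
Local Notation k := (kfun k1 k2 k3).
Local Notation T i := (vmap (dunkl k i)).
Local Notation R i := (vmap (refl i)).

Definition dirac (v : V) : V := sig i1 (T i1 v) + sig i2 (T i2 v) + sig i3 (T i3 v).

Definition angT (a b : 'I_3) (v : V) : V :=
  vmap (fun f => 'X_a * dunkl k b f - 'X_b * dunkl k a f) v.

Definition BIop (g : 'I_3) (v : V) : V :=
  if g == i1 then
    'i *: sig i1 (angT i3 i2 (R i2 (R i3 v))) + 2^-1 *: R i2 (R i3 v)
      + k2 *: R i3 v + k3 *: R i2 v
  else if g == i2 then
    'i *: sig i2 (angT i1 i3 (R i1 (R i3 v))) + 2^-1 *: R i1 (R i3 v)
      + k3 *: R i1 v + k1 *: R i3 v
  else
    'i *: sig i3 (angT i2 i1 (R i1 (R i2 v))) + 2^-1 *: R i1 (R i2 v)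
      + k1 *: R i2 v + k2 *: R i1 v.

Definition Mn (n : nat) (v : V) : Prop :=
  v.1 \is n.-homog /\ v.2 \is n.-homog /\ dirac v = 0.

(* M_n(x_i) for threshold t_i = t (finite):
   M_n meets (+)_{j=t}^n C^2 (x) x_i^j R[x_p,x_q]_{n-j} *)
Definition Mnx (n : nat) (i : 'I_3) (t : nat) (v : V) : Prop :=
  Mn n v /\ forall m, m \in msupp v.1 ++ msupp v.2 -> (t <= m i)%N.

End Dunkl.

Definition is_t (C : numClosedFieldType) (k : C) (t : nat) : Prop :=
  odd t /\ 2 * k = - (t%:R).
(* "n < t_i" (t_i possibly infinite) *)
Definition lt_t (C : numClosedFieldType) (k : C) (n : nat) : Prop :=
  forall t, is_t k t -> (n < t)%N.

Section Leonard.
Variable C : numClosedFieldType.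

Definition theta (d : nat) (a : C) (i : nat) : C :=
  (-1) ^+ i * (2 * a - d%:R + 2 * i%:R) / 2.

(* w.r.t. basis v_0..v_d: column j = image of v_j *)
Definition LX (d : nat) (a : C) : 'M[C]_d.+1 :=
  \matrix_(r, c) (if r == c :> nat then theta d a c
                  else if r == c.+1 :> nat then 1 else 0).
Definition LY (d : nat) (b : C) (phi : nat -> C) : 'M[C]_d.+1 :=
  \matrix_(r, c) (if r == c :> nat then theta d b c
                  else if r.+1 == c :> nat then phi (c : nat) else 0).

Definition phiE (d : nat) (a b c : C) (i : nat) : C :=
  if ~~ odd i then (i * (d - i + 1))%:R
  else c ^+ 2 - (2 * a + 2 * b - d%:R + 2 * i%:R - 1) ^+ 2 / 4.
Definition phiO (d : nat) (a b c : C) (i : nat) : C :=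
  if ~~ odd i then i%:R * (d%:R + 1 - 2 * i%:R - 2 * a - 2 * b - 2 * c) / 2
  else (i%:R - d%:R - 1) * (d%:R + 1 - 2 * i%:R - 2 * a - 2 * b + 2 * c) / 2.

(* a BI-module on C^(d+1) is given by the actions of X, Y, Z (indices i1,i2,i3) *)
Definition anticomm (d : nat) (A B : 'M[C]_d.+1) := A *m B + B *m A.

(* E_d(a,b,c) (used for d odd) *)
Definition Emod (d : nat) (a b c : C) (g : 'I_3) : 'M[C]_d.+1 :=
  let X := LX d a in let Y := LY d b (phiE d a b c) in
  if g == i1 then X else if g == i2 then Y
  else anticomm X Y - (c ^+ 2 - a ^+ 2 - b ^+ 2 + (d%:R + 1) ^+ 2 / 4)%:M.

(* O_d(a,b,c) (used for d even) *)
Definition Omod (d : nat) (a b c : C) (g : 'I_3) : 'M[C]_d.+1 :=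
  let X := LX d a in let Y := LY d b (phiO d a b c) in
  if g == i1 then X else if g == i2 then Y
  else anticomm X Y - (2 * a * b - c * (d%:R + 1))%:M.

End Leonard.

(* Twisting V^eps, for eps = (sign automorphism) o (permutation sigma):
   generator i acts on V^eps as eps(gen_i) = s(sigma i) * gen_(sigma i). *)
Section Twist.
Variable C : numClosedFieldType.
Variable T : lmodType C.
Definition twist_aut (s : 'I_3 -> C) (sigma : 'I_3 -> 'I_3)
   (ops : 'I_3 -> T) : 'I_3 -> T := fun i => s (sigma i) *: ops (sigma i).
End Twist.

Definition perm13 (i : 'I_3) : 'I_3 :=
  if i == i1 then i3 else if i == i3 then i1 else i2.
Definition perm132 (i : 'I_3) : 'I_3 :=
  if i == i1 then i3 else if i == i3 then i2 else i1.
Definition sgn_1m (C : numClosedFieldType) (i : 'I_3) : C :=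
  if i == i1 then 1 else -1.
Definition sgn_m1 (C : numClosedFieldType) (i : 'I_3) : C :=
  if i == i2 then 1 else -1.
Definition sgn_mm (C : numClosedFieldType) (i : 'I_3) : C :=
  if i == i3 then 1 else -1.

Section Iso.
Variable C : numClosedFieldType.

Definition dsum (m : nat) (W : 'I_3 -> 'M[C]_m) (g : 'I_3) : 'M[C]_(m + m) :=
  block_mx (W g) 0 0 (W g).

(* A/B is isomorphic, as BI-module, to C^m with actions W: there is a linear
   map phi from A onto C^m, with kernel B (within A), intertwining X, Y, Z.
   (first isomorphism theorem; A, B are BI-submodules of the ambient space) *)
Definition quot_iso (V : lmodType C) (ops : 'I_3 -> V -> V) (A B : V -> Prop)
   (m : nat) (W : 'I_3 -> 'M[C]_m) : Prop :=
  exists phi : V -> 'cV[C]_m,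
    [/\ forall (c : C) a b, A a -> A b -> phi (c *: a + b) = c *: phi a + phi b,
        forall w, exists2 a, A a & phi a = w,
        forall a, A a -> (phi a = 0 <-> B a)
      & forall g a, A a -> phi (ops g a) = W g *m phi a].

Definition mod_iso (m : nat) (W W' : 'I_3 -> 'M[C]_m) : Prop :=
  exists2 Q : 'M[C]_m, Q \in unitmx & forall g, Q *m W g = W' g *m Q.

Definition irreducible (m : nat) (W : 'I_3 -> 'M[C]_m) : Prop :=
  forall S : 'cV[C]_m -> Prop,
    S 0 -> (forall (c : C) u v, S u -> S v -> S (c *: u + v)) ->
    (forall g v, S v -> S (W g *m v)) ->
    (forall v, S v -> v = 0) \/ (forall v, S v).

End Iso.

(* Main.v *)
(** Since n < t_1, an element of M_n is determined by its restriction to x_1 = 0,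
    which is an arbitrary element of C^2 (x) C[x_2,x_3]_n (Cauchy-Kovalevskaya
    extension). On restrictions X, Y, Z commute with e_1, so M_n splits into two
    isomorphic halves, in which the monomials x_2^(n-j) x_3^j make Y lower and Z
    upper bidiagonal, and X = {Y, Z} - kappa. As T_i kills x_i^(t_i), M_n(x_2) and
    M_n(x_3) are spanned by the monomials with n - j >= t_2, resp. j >= t_3, and
    every subquotient of the theorem is a window of consecutive values of j whose
    bidiagonal entries are those of the modules E_d and O_d.

    For the last part, a bidiagonal pair satisfying the relations of BI is
    determined by its two diagonals and two further parameters. If B u = th*_0 u
    and (B - th*_1) A u is a multiple of u, then the vectors
    (A - th_(i-1)) ... (A - th_0) u form a basis adapted to such a pair. Reordering
    the th_i, or replacing A by the third generator, gives other bidiagonal forms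
    of the same module; the irreducibility criterion uses a reordering on the dual
    side. *)
Require Import Defs.
From HB Require Import structures.
From mathcomp Require Import all_boot all_order all_algebra.
From mathcomp Require Import mpoly.
From mathcomp Require Import ring zify.
From Stdlib Require Import Classical_Prop.
Set Implicit Arguments. Unset Strict Implicit. Unset Printing Implicit Defensive.
Import GRing.Theory Num.Theory.
Local Open Scope ring_scope.

(** * Bidiagonal pairs satisfying the Bannai-Ito relations *)

Require Import Defs.
From HB Require Import structures.
From mathcomp Require Import all_boot all_order all_algebra.
From mathcomp Require Import mpoly.
From mathcomp Require Import ring zify.
Set Implicit Arguments. Unset Strict Implicit. Unset Printing Implicit Defensive.
Import GRing.Theory Num.Theory.
Local Open Scope ring_scope.

Section SplitBasis.
Variable C : numClosedFieldType.
Implicit Types (al be ro ta : C).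

(** Eliminating [D] from two of the Bannai-Ito relations leaves [A^2 B + 2 A B A + B A^2 - 2 ka A =
    B + mu]. Apply this to the k-th vector of a chain. The coefficient at k+2 cancels because th*_k
    + 2 th*_(k+1) + th*_(k+2) = 0 for the alternating sequences used here, and the one at k-1
    because consecutive th_i add up to 1 or -1. The coefficients at k+1 and k give a recursion for
    the superdiagonal and an invariant. Hence [B] is bidiagonal along the whole chain once it is so
    on the first two vectors. The condition on the second vector is the real obstacle in each
    isomorphism, since it does not follow from [u] being an eigenvector of [B]. It is read off
    explicit matrices when [u] is explicit, and otherwise deduced from the absence of one eigenvalue
    of [B]. A second missing eigenvalue makes the chain stop after d + 1 vectors. Irreducibility has
    to come before the isomorphisms, because it is what makes the intertwining matrix invertible. *)

Lemma eq_by_multiple (k a b c e : C) : a = b -> c - e = k * (a - b) -> c = e.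
Proof. by move=> ->; rewrite subrr mulr0 => /subr0_eq. Qed.

Definition altseq al (i : nat) : C := (-1) ^+ i * (al + i%:R).

(* For E_d, ro and ta are -(c + g) and c - g with g = a + b - (d + 1) / 2, and the
   implied third parameter is d + 1; for O_d, ro = d + 1. In both cases
   al = a - d / 2 and be = b - d / 2. *)
Definition split_phi al be ro ta (i : nat) : C :=
  if odd i then (i%:R - ro) * (ta - i%:R)
  else i%:R * (2 - 2 * al - 2 * be - ro - ta - i%:R).

(** The scalars by which [{A,B} - D] and, in the next definition, [{D,A} - B] act on a split module.
    Exchanging [al] and [be] in the second one gives [{B,D} - A]. *)
Definition split_kappa al be ro ta : C :=
  (2 * al - 1) * (2 * be - 1) / 2 - ro * ta.

Definition split_mu al be ro ta : C :=
  (2 * al - 1) * (ro + ta - 1 + al + be) + ro * ta.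

Lemma altseqS al i : altseq al i.+1 = - altseq al i - (-1) ^+ i.
Proof. by rewrite /altseq exprS -addn1 natrD; ring. Qed.

Lemma split_phiC al be ro ta i : split_phi al be ro ta i = split_phi be al ro ta i.
Proof. by rewrite /split_phi; case: odd => //; ring. Qed.

(** The coefficient of [v_(k+1)] in the cubic relation applied to [v_k], solved for the newest
    superdiagonal entry. *)
Lemma split_rec_kappa al be ro ta k :
  split_phi al be ro ta k.+2 =
  - ((altseq al k + altseq al k.+1) * (altseq be k + altseq be k.+1)
     + 2 * (altseq al k * altseq be k + altseq al k.+1 * altseq be k.+1)
     + 2 * split_phi al be ro ta k.+1 + split_phi al be ro ta k
     - 2 * split_kappa al be ro ta).
Proof.
rewrite /split_phi /split_kappa /altseq /= !negbK -[k.+2]addn2 -[k.+1]addn1 !natrD.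
rewrite !exprD expr1 -signr_odd.
by case: (odd k) => /=; field.
Qed.

(** The coefficient of [v_k] in the same relation. The left side turns out to be independent of [k],
    so one scalar [mu] serves all rows. *)
Lemma split_rec_mu al be ro ta k :
  split_phi al be ro ta k.+1 * (3 * altseq al k + altseq al k.+1)
  + split_phi al be ro ta k * (2 * altseq al k + (-1) ^+ k)
  + 4 * altseq al k ^+ 2 * altseq be k
  - 2 * split_kappa al be ro ta * altseq al k - altseq be k
  = split_mu al be ro ta.
Proof.
rewrite /split_phi /split_kappa /split_mu /altseq /= -[k.+1]addn1 !natrD.
rewrite !exprD expr1 -signr_odd.
by case: (odd k) => /=; rewrite ?expr0 ?expr1; field.
Qed.

Definition BIrel d (A B D : 'M[C]_d.+1) (ka la mu : C) :=
  [/\ anticomm A B = D + ka%:M, anticomm B D = A + la%:M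
    & anticomm D A = B + mu%:M].

(** Substituting [D = {A,B} - ka] into the third relation. It is solved for [B A A w], the only term
    in which [B] meets a new chain vector. *)
Lemma BIrel_cubic d (A B D : 'M[C]_d.+1) ka la mu (w : 'cV_d.+1) :
  BIrel A B D ka la mu ->
  B *m (A *m (A *m w)) = (2 * ka) *: (A *m w) + B *m w + mu *: w
     - A *m (A *m (B *m w)) - 2 *: (A *m (B *m (A *m w))).
Proof.
case=> h1 _ h3.
have hD : D = anticomm A B - ka%:M by rewrite h1 addrK.
move/(congr1 (mulmx^~ w)): h3; rewrite {}hD /anticomm.
rewrite !(mulmxDl, mulmxBl, mulmxDr, mulmxBr) -!mulmxA.
rewrite !mulNmx !mulmxN !mul_scalar_mx -!scalemxAr => /matrixP e.
apply/matrixP=> i j; have := e i j; rewrite !mxE => h.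
by apply: (@eq_by_multiple 1 _ _ _ _ h); ring.
Qed.

Lemma BIrel_rot d (A B D : 'M[C]_d.+1) ka la mu :
  BIrel A B D ka la mu -> BIrel B D A la mu ka.
Proof. by case. Qed.

Lemma BIrel_swap d (A B D : 'M[C]_d.+1) ka la mu :
  BIrel A B D ka la mu -> BIrel D B A la ka mu.
Proof. by case=> h1 h2 h3; split; rewrite /anticomm addrC. Qed.

Fixpoint chain d (A : 'M[C]_d.+1) (th : nat -> C) (u : 'cV[C]_d.+1) (i : nat) :=
  if i is j.+1 then A *m chain A th u j - th j *: chain A th u j else u.

Lemma chainS d (A : 'M[C]_d.+1) th u i :
  A *m chain A th u i = th i *: chain A th u i + chain A th u i.+1.
Proof. by rewrite /= addrC subrK. Qed.

(** The cubic relation gives [B] two steps ahead from the two preceding vectors, so the induction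
    carries two consecutive indices and needs two starting conditions. Neither independence nor the
    length of the chain enters. *)
Lemma chain_up d (A B D : 'M[C]_d.+1) al be ro ta la u :
  BIrel A B D (split_kappa al be ro ta) la (split_mu al be ro ta) ->
  B *m u = be *: u ->
  B *m (A *m u) = - (be + 1) *: (A *m u)
                  + (split_phi al be ro ta 1 + al * (2 * be + 1)) *: u ->
  forall i, B *m chain A (altseq al) u i.+1 =
    altseq be i.+1 *: chain A (altseq al) u i.+1
    + split_phi al be ro ta i.+1 *: chain A (altseq al) u i.
Proof.
move=> rel Bu BAu.
pose v := chain A (altseq al) u; pose th := altseq al; pose ph := split_phi al be ro ta.
(* The predecessor, with 0 before the start. It only occurs multiplied by [ph k], and [ph 0 = 0], so
   the formula [eA'] needs no exception at [k = 0]. *)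
pose v' k := if k is j.+1 then v j else 0.
suff Q k : (B *m v k = altseq be k *: v k + ph k *: v' k) /\
    (B *m v k.+1 = altseq be k.+1 *: v k.+1 + ph k.+1 *: v k).
  by move=> i; case: (Q i).
elim: k => [|k [IHk IHk1]].
  split; first by rewrite /= scaler0 addr0 Bu /altseq expr0 mul1r addr0.
  rewrite /v /= mulmxBr BAu -scalemxAr Bu /altseq expr0 expr1.
  by apply/matrixP=> i j; rewrite !mxE /ph; ring.
split=> //.
have eA1 : A *m v k.+1 = th k.+1 *: v k.+1 + v k.+2 by rewrite chainS.
have eA0 : A *m v k = th k *: v k + v k.+1 by rewrite chainS.
have eA' : ph k *: (A *m v' k) = ph k *: (v k + (- th k + (-1) ^+ k) *: v' k).
  case: (k) => [|j] /=; first by rewrite /ph /split_phi /= mul0r !scale0r.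
  rewrite chainS addrC; congr (_ *: (_ + _ *: _)).
  by rewrite /th altseqS exprS; ring.
have := BIrel_cubic (v k) rel.
have eAv' w x : A *m (w + ph k *: x) = A *m w + ph k *: (A *m x).
  by rewrite mulmxDr -scalemxAr.
have EAA : A *m (A *m v k) = th k ^+ 2 *: v k + (th k + th k.+1) *: v k.+1 + v k.+2.
  rewrite eA0 mulmxDr -scalemxAr eA0 eA1.
  by apply/matrixP=> i j; rewrite !mxE; ring.
have EAB : A *m (B *m v k) = altseq be k *: (th k *: v k + v k.+1)
    + ph k *: (v k + (- th k + (-1) ^+ k) *: v' k).
  by rewrite IHk eAv' -scalemxAr eA0 eA'.
have EAAB : A *m (A *m (B *m v k)) = altseq be k *: (th k ^+ 2 *: v k
       + (th k + th k.+1) *: v k.+1 + v k.+2)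
    + ph k *: (th k *: v k + v k.+1)
    + (- th k + (-1) ^+ k) *: (ph k *: (v k + (- th k + (-1) ^+ k) *: v' k)).
  rewrite EAB mulmxDr -!scalemxAr -eA0 EAA [A *m (v k + _)]mulmxDr -scalemxAr.
  rewrite [ph k *: (_ + _)]scalerDr eA0 addrA; congr (_ + _).
  by rewrite scalerA mulrC -scalerA eA'.
have EABA : A *m (B *m (A *m v k)) =
   th k *: (altseq be k *: (th k *: v k + v k.+1)
      + ph k *: (v k + (- th k + (-1) ^+ k) *: v' k))
   + altseq be k.+1 *: (th k.+1 *: v k.+1 + v k.+2) + ph k.+1 *: (th k *: v k + v k.+1).
  rewrite eA0 mulmxDr -scalemxAr mulmxDr -scalemxAr EAB IHk1.
  by rewrite mulmxDr -!scalemxAr eA0 eA1 addrA.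
rewrite EAAB EABA EAA !mulmxDr -!scalemxAr IHk IHk1 eA0.
(* Isolates [B *m v k.+2]; the other terms are by now combinations of four chain vectors. *)
move/(canRL (addKr _)) => ->.
have e1 := split_rec_kappa al be ro ta k.
have e2 := split_rec_mu al be ro ta k.
rewrite -e2 /ph e1 /th !altseqS [(-1) ^+ k.+1]exprS -signr_odd.
move: (split_phi al be ro ta k) (split_phi al be ro ta k.+1) => f0 f1.
move: (v k) (v k.+1) (v k.+2) (v' k) => x y z w.
apply/matrixP=> i j; rewrite !mxE.
by case: (odd k); rewrite ?expr0 ?expr1; ring.
Qed.

End SplitBasis.

(** * Bidiagonal matrices satisfy the Bannai-Ito relations *)

Section SplitModules.
Variable C : numClosedFieldType.
Implicit Types (al be ro ta ka la mu : C).

(** Indexed by all naturals and 0 past [d], so that the bidiagonal formulas have no case at the last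
    row. *)
Definition ev d (i : nat) : 'cV[C]_d.+1 := \col_r (r == i :> nat)%:R.

Lemma split_kappaC al be ro ta : split_kappa al be ro ta = split_kappa be al ro ta.
Proof. by rewrite /split_kappa [_ * (2 * be - 1)]mulrC. Qed.

Lemma ev_gt d i : (d < i)%N -> ev d i = 0.
Proof.
move=> lt_di; apply/matrixP=> r j; rewrite !mxE.
by have := ltn_ord r; case: eqP => //=; lia.
Qed.

Lemma mulmx_ev d m (M : 'M[C]_(m, d.+1)) (i : 'I_d.+1) : M *m ev d i = col i M.
Proof.
apply/matrixP=> r j; rewrite !mxE (bigD1 i) //= big1 ?addr0 ?mxE ?eqxx ?mulr1 //.
by move=> k ne_ki; rewrite mxE (negPf (ne_ki : k != i :> nat)) mulr0.
Qed.

Lemma eq_mulmx_ev d m (M M' : 'M[C]_(m, d.+1)) :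
  (forall i, (i <= d)%N -> M *m ev d i = M' *m ev d i) -> M = M'.
Proof.
move=> eqM; apply/matrixP=> r i.
have := eqM i; rewrite -ltnS ltn_ord !mulmx_ev => /(_ isT)/matrixP/(_ r 0).
by rewrite !mxE.
Qed.

Lemma theta_altseq d (a : C) i : theta d a i = altseq (a - d%:R / 2) i.
Proof. by rewrite /theta /altseq; field. Qed.

Lemma LX_ev d (a : C) i :
  LX d a *m ev d i = theta d a i *: ev d i + ev d i.+1.
Proof.
have [lt_di|le_id] := ltnP d i.
  by rewrite !ev_gt ?(leqW lt_di) // mulmx0 scaler0 addr0.
rewrite (mulmx_ev _ (Ordinal (le_id : (i < d.+1)%N))).
apply/matrixP=> r j; rewrite !mxE /=; case: eqP => [->|ne_ri].
  by rewrite mulr1 (ltn_eqF (ltnSn i)) addr0.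
by rewrite mulr0 add0r; case: eqP.
Qed.

Lemma LY_ev0 d (b : C) phi : LY d b phi *m ev d 0 = theta d b 0 *: ev d 0.
Proof.
rewrite (mulmx_ev _ ord0).
by apply/matrixP=> r j; rewrite !mxE /=; case: eqP; rewrite ?mulr1 ?mulr0.
Qed.

Lemma LY_evS d (b : C) phi i : phi d.+1 = 0 ->
  LY d b phi *m ev d i.+1 = theta d b i.+1 *: ev d i.+1 + phi i.+1 *: ev d i.
Proof.
move=> phi0; have [lt_di|le_id] := ltnP d i.+1.
  rewrite [ev d i.+1]ev_gt // mulmx0 scaler0 add0r.
  by move: lt_di; rewrite ltnS leq_eqVlt => /predU1P[<-|/ev_gt->];
    rewrite ?phi0 ?scale0r ?scaler0.
rewrite (mulmx_ev _ (Ordinal (le_id : (i.+1 < d.+1)%N))).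
apply/matrixP=> r j; rewrite !mxE /= eqSS; case: eqP => [->|ne_ri].
  by rewrite mulr1 (gtn_eqF (ltnSn i)) mulr0 addr0.
by rewrite mulr0 add0r; case: eqP; rewrite ?mulr1 ?mulr0.
Qed.

Lemma LYE d (b : C) phi phi' :
  (forall i, (0 < i <= d)%N -> phi i = phi' i) -> LY d b phi = LY d b phi'.
Proof.
move=> eqphi; apply/matrixP=> r s; rewrite !mxE; case: ifP => // _; case: ifP => // /eqP e.
by rewrite eqphi //; have := ltn_ord s; lia.
Qed.

(* The sum of the three parameters of split_phi is fixed by al and be, so the
   entries past the last row vanish exactly when one of them equals d + 1. *)
Lemma BIrel_split d (a b : C) ro ta phi :
  let al := a - d%:R / 2 in let be := b - d%:R / 2 in
  let ka := split_kappa al be ro ta in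
  (forall i, (0 < i <= d)%N -> phi i = split_phi al be ro ta i) ->
  split_phi al be ro ta d.+1 = 0 ->
  BIrel (LX d a) (LY d b phi) (anticomm (LX d a) (LY d b phi) - ka%:M)
    ka (split_mu be al ro ta) (split_mu al be ro ta).
Proof.
move=> al be ka eqphi phi0; rewrite (LYE b eqphi).
set A := LX d a; set B := LY d b _.
have eA i : A *m ev d i = altseq al i *: ev d i + ev d i.+1.
  by rewrite LX_ev theta_altseq.
pose ph := split_phi al be ro ta.
have eB0 : B *m ev d 0 = altseq be 0 *: ev d 0 by rewrite LY_ev0 theta_altseq.
have eBS i : B *m ev d i.+1 = altseq be i.+1 *: ev d i.+1 + ph i.+1 *: ev d i.
  by rewrite LY_evS // theta_altseq.
have lin (M : 'M[C]_d.+1) c (v : 'cV[C]_d.+1) : M *m (c *: v) = c *: (M *m v).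
  by rewrite scalemxAr.
have ph0 : ph 0 = 0 by rewrite /ph /split_phi mul0r.
have sg k : ((-1) ^+ k : C) = (-1) ^+ odd k by rewrite signr_odd.
split; first by rewrite subrK.
(* Here [B] is applied twice, so the indices 0 and 1 are separate cases; in the last relation it
   occurs once and only 0 is. *)
- apply: eq_mulmx_ev => k _; rewrite /anticomm !(mulmxDl, mulmxDr, mulNmx, mulmxN).
  rewrite -!mulmxA !mul_scalar_mx !lin.
  have e1 := split_rec_mu be al ro ta k.
  rewrite -e1 !(split_phiC be al) (split_kappaC be al) -/ph /ka.
  case: k e1 => [|k] _.
    rewrite !(mulmxDr, eA, eB0, eBS, lin) -/ph ph0 !altseqS expr0.
    by apply/matrixP=> r j; rewrite !mxE; ring.
  have e2 : ph k.+2 = _ := split_rec_kappa al be ro ta k.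
  case: k e2 => [|k] e2.
    rewrite !(mulmxDr, eA, eB0, eBS, lin) e2 -/ph ph0 !altseqS expr0 expr1.
    by apply/matrixP=> r j; rewrite !mxE; ring.
  rewrite !(mulmxDr, eA, eB0, eBS, lin) e2 -/ph !altseqS !exprS sg.
  by apply/matrixP=> r j; rewrite !mxE; case: odd; rewrite ?expr0 ?expr1; ring.
- apply: eq_mulmx_ev => k _; rewrite /anticomm !(mulmxDl, mulmxDr, mulNmx, mulmxN).
  rewrite -!mulmxA !mul_scalar_mx !lin.
  have e1 := split_rec_mu al be ro ta k; rewrite -e1 -/ph /ka.
  have e2 : ph k.+2 = _ := split_rec_kappa al be ro ta k.
  case: k e1 e2 => [|k] _ e2.
    rewrite !(mulmxDr, eA, eB0, eBS, lin) e2 -/ph ph0 !altseqS expr0 expr1.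
    by apply/matrixP=> r j; rewrite !mxE; ring.
  rewrite !(mulmxDr, eA, eB0, eBS, lin) e2 -/ph !altseqS !exprS sg.
  by apply/matrixP=> r j; rewrite !mxE; case: odd; rewrite ?expr0 ?expr1; ring.
Qed.

End SplitModules.

(** * Irreducibility through the dual chain *)

Section SplitIrreducible.
Variable C : numClosedFieldType.
Implicit Types (al be ro ta ka la mu : C).

Definition irreducible_pair d (A B : 'M[C]_d.+1) : Prop :=
  forall S : 'cV[C]_d.+1 -> Prop,
    S 0 -> (forall (c : C) u v, S u -> S v -> S (c *: u + v)) ->
    (forall v, S v -> S (A *m v)) -> (forall v, S v -> S (B *m v)) ->
    (forall v, S v -> v = 0) \/ (forall v, S v).

Lemma irreducible_pairW d (A B : 'M[C]_d.+1) (W : 'I_3 -> 'M[C]_d.+1) g h (s s' : C) :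
  irreducible_pair A B -> A = s *: W g -> B = s' *: W h -> irreducible W.
Proof.
move=> irrAB eA eB S S0 Slin SW.
have SZ c v : S v -> S (c *: v) by move=> Sv; rewrite -[_ *: _]addr0; apply: Slin.
by apply: irrAB => // v Sv; rewrite ?eA ?eB -scalemxAl; apply/SZ/SW.
Qed.

Lemma trig_eigen0 n (A : 'M[C]_n) c (w : 'cV_n) :
  is_trig_mx A || is_trig_mx A^T -> (forall i, A i i != c) -> A *m w = c *: w -> w = 0.
Proof.
move=> trA neA eAw.
have unitA : A - c%:M \in unitmx.
  rewrite unitmxE; wlog trA' : A {trA neA eAw} trA neA / is_trig_mx A.
    case/orP: (trA) => trA' H; first by apply: H.
    rewrite -det_tr linearB /= tr_scalar_mx; apply: H => //; first by rewrite trA'.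
    by move=> i; rewrite mxE.
  rewrite det_trig; last first.
    apply/is_trig_mxP=> i j lt_ij; rewrite !mxE (is_trig_mxP _) //.
    by rewrite -val_eqE (ltn_eqF lt_ij) subrr.
  by rewrite unitfE; apply/prodf_neq0 => i _; rewrite !mxE eqxx subr_eq0.
by rewrite -(mulKmx unitA w) mulmxBl eAw mul_scalar_mx subrr mulmx0.
Qed.

Lemma trig_eigenvector n (A : 'M[C]_n) i :
  is_trig_mx A^T -> exists2 w : 'cV_n, w != 0 & A *m w = A i i *: w.
Proof.
move=> trA; have /det0P[w nz_w Aw] : \det (A^T - (A i i)%:M) == 0.
  rewrite det_trig; last first.
    apply/is_trig_mxP=> r j lt_rj; rewrite !mxE.
    have /is_trig_mxP/(_ r j lt_rj) := trA; rewrite mxE => ->.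
    by rewrite -val_eqE (ltn_eqF lt_rj) subrr.
  by apply/prodf_eq0; exists i; rewrite // !mxE eqxx subrr.
exists w^T; first by rewrite trmx_eq0.
apply: trmx_inj; rewrite trmx_mul linearZ /= trmxK.
by apply/eqP; rewrite -subr_eq0 -mul_mx_scalar -mulmxBr Aw.
Qed.

Lemma LX_trig d (a : C) : is_trig_mx (LX d a).
Proof. by apply/is_trig_mxP=> i j lt_ij; rewrite mxE !ltn_eqF // ltnW. Qed.

Lemma LY_trig d (b : C) phi : is_trig_mx (LY d b phi)^T.
Proof. by apply/is_trig_mxP=> i j lt_ij; rewrite !mxE !gtn_eqF // ltnW. Qed.

Lemma LX_eigen0 d (a c : C) (w : 'cV_d.+1) : (forall i, (i <= d)%N -> theta d a i != c) ->
  LX d a *m w = c *: w -> w = 0.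
Proof.
move=> ne; apply: trig_eigen0 => [|i]; first by rewrite LX_trig.
by rewrite mxE eqxx ne // -ltnS.
Qed.

Lemma LY_eigen0 d (b c : C) phi (w : 'cV_d.+1) : (forall i, (i <= d)%N -> theta d b i != c) ->
  LY d b phi *m w = c *: w -> w = 0.
Proof.
move=> ne; apply: trig_eigen0 => [|i]; first by rewrite LY_trig orbT.
by rewrite mxE eqxx ne // -ltnS.
Qed.

Lemma LY_eigenvector d (b : C) phi i : (i <= d)%N ->
  exists2 w : 'cV_d.+1, w != 0 & LY d b phi *m w = theta d b i *: w.
Proof.
rewrite -ltnS => le_id; have := trig_eigenvector (Ordinal le_id) (LY_trig d b phi).
by rewrite mxE eqxx.
Qed.

Lemma trLY_ev d (b : C) phi i : (i <= d)%N ->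
  (LY d b phi)^T *m ev C d i = theta d b i *: ev C d i + phi i.+1 *: ev C d i.+1.
Proof.
move=> le_id; rewrite (mulmx_ev _ (Ordinal (le_id : (i < d.+1)%N))).
apply/matrixP=> r j; rewrite !mxE /= [i == r :> nat]eq_sym [i.+1 == r :> nat]eq_sym.
case: eqP => [->|_]; first by rewrite mulr1 (ltn_eqF (ltnSn i)) mulr0 addr0.
by rewrite mulr0 add0r; case: eqP => [->|]; rewrite ?mulr1 ?mulr0.
Qed.

Lemma trLX_ev0 d (a : C) : (LX d a)^T *m ev C d 0 = theta d a 0 *: ev C d 0.
Proof.
rewrite (mulmx_ev _ ord0).
by apply/matrixP=> r j; rewrite !mxE /=; case: (nat_of_ord r) => [|k]; rewrite /= ?mulr1 ?mulr0.
Qed.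

Lemma trLX_evS d (a : C) i : (i < d)%N ->
  (LX d a)^T *m ev C d i.+1 = theta d a i.+1 *: ev C d i.+1 + ev C d i.
Proof.
move=> lt_id; rewrite (mulmx_ev _ (Ordinal (lt_id : (i.+1 < d.+1)%N))).
apply/matrixP=> r j; rewrite !mxE /= eqSS [i.+1 == r :> nat]eq_sym [i == r :> nat]eq_sym.
case: eqP => [->|_].
  by rewrite mulr1 (gtn_eqF (ltnSn i)) addr0.
by rewrite mulr0 add0r; case: eqP.
Qed.

Lemma chain_comm d (M : 'M[C]_d.+1) th v k :
  chain M th (M *m v) k = M *m chain M th v k.
Proof. by elim: k => //= k ->; rewrite mulmxBr -scalemxAr. Qed.

Lemma chain_tr d (M : 'M[C]_d.+1) th u v k :
  (chain M^T th u k)^T *m v = u^T *m chain M th v k.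
Proof.
elim: k v => //= k IHk v.
rewrite linearB linearZ /= trmx_mul trmxK mulmxBl -mulmxA -scalemxAl !IHk.
by rewrite chain_comm mulmxBr -scalemxAr.
Qed.

Lemma BIrel_tr d (A B D : 'M[C]_d.+1) ka la mu :
  BIrel A B D ka la mu -> BIrel A^T B^T D^T ka la mu.
Proof.
have tr_anti (M N : 'M[C]_d.+1) : anticomm M^T N^T = (anticomm M N)^T.
  by rewrite /anticomm linearD /= !trmx_mul addrC.
by case=> h1 h2 h3; split; rewrite tr_anti ?h1 ?h2 ?h3 linearD /= tr_scalar_mx.
Qed.

Lemma BIrel_sign d (A B D : 'M[C]_d.+1) s ka la mu : s ^+ 2 = 1 ->
  BIrel A B D ka la mu -> BIrel (s *: A) B (s *: D) (s * ka) (s * la) mu.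
Proof.
move=> s2 [h1 h2 h3]; split; rewrite /anticomm -?scalemxAl -?scalemxAr -?scalerDr.
- by rewrite -[A *m B + _]/(anticomm A B) h1 scalerDr scale_scalar_mx.
- by rewrite -[B *m D + _]/(anticomm B D) h2 scalerDr scale_scalar_mx.
by rewrite !scalerA -expr2 s2 !scale1r.
Qed.

Lemma sign_sqr k : ((-1) ^+ k * (-1) ^+ k : C) = 1.
Proof. by rewrite -exprMn mulrNN mulr1 expr1n. Qed.

(** A spectrum read backwards is again an alternating sequence, up to a global sign when [d] is
    even. This is why the dual chain uses [s B^T] with starting value [- be - d]. *)
Lemma altseq_rev d be i : (i <= d)%N ->
  altseq be (d - i) = (-1) ^+ d.+1 * altseq (- be - d%:R) i.
Proof.
move=> le_id; have ed : ((-1) ^+ d : C) = (-1) ^+ (d - i) * (-1) ^+ i.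
  by rewrite -exprD subnK.
rewrite /altseq natrB // exprS ed.
have ei := sign_sqr i.
set e := (-1) ^+ (d - i); set f : C := (-1) ^+ i in ei *.
transitivity (f * f * (e * (be + (d%:R - i%:R)))); first by rewrite ei mul1r.
by ring.
Qed.

(* A vector not killed by the last row of the chain of s B^T yields ev 0 inside
   the submodule; if there is none, A lowers that row down to ev 0 and then all
   coordinates vanish. *)
Lemma split_irreducible d (a b : C) ro ta phi ro' ta' :
  let al := a - d%:R / 2 in let be := b - d%:R / 2 in let be' := - be - d%:R in
  let s : C := (-1) ^+ d.+1 in
  (forall i, (0 < i <= d)%N -> phi i = split_phi al be ro ta i) ->
  split_phi al be ro ta d.+1 = 0 ->
  s * split_kappa al be ro ta = split_kappa be' al ro' ta' ->
  split_mu be al ro ta = split_mu be' al ro' ta' ->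
  s * (be * (2 * al + 1) + split_phi al be ro ta 1)
    = be' * (2 * al + 1) + split_phi be' al ro' ta' 1 ->
  (forall i, (0 < i <= d)%N -> phi i != 0) ->
  (forall i, (0 < i <= d)%N -> split_phi be' al ro' ta' i != 0) ->
  irreducible_pair (LX d a) (LY d b phi).
Proof.
move=> al be be' s eqphi phi0 eka emu ebase nz_phi nz_phi'.
have s2 : s ^+ 2 = 1 by rewrite expr2 sign_sqr.
pose ph := split_phi al be ro ta; pose ph' := split_phi be' al ro' ta'.
have {nz_phi} nz_ph i : (0 < i <= d)%N -> ph i != 0.
  by move=> lt_i; rewrite /ph -eqphi ?nz_phi.
rewrite (LYE b eqphi) -/ph; set A := LX d a; set B := LY d b ph.
have := @BIrel_split C d a b ro ta ph (fun _ _ => erefl) phi0; rewrite -/al -/be -/A -/B.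
set D := anticomm A B - _ => rel.
(* After transposing, [s B^T] takes the role of [A] and [A^T] that of [B]. The hypotheses on [ro']
   and [ta'] say that the constants are again of split form. *)
have := BIrel_sign s2 (BIrel_rot (BIrel_swap (BIrel_tr rel))).
rewrite eka emu => rel'.
have eB i : (i <= d)%N ->
    B^T *m ev C d i = altseq be i *: ev C d i + ph i.+1 *: ev C d i.+1.
  by move=> le_id; rewrite trLY_ev // theta_altseq.
have eA0 : A^T *m ev C d 0 = al *: ev C d 0.
  by rewrite trLX_ev0 theta_altseq /altseq expr0 mul1r addr0.
(* The factor [ph 1] covers [d = 0], where it is the vanishing entry [ph d.+1]. *)
have eA1 : ph 1 *: (A^T *m ev C d 1) = ph 1 *: (- (al + 1) *: ev C d 1 + ev C d 0).
  case: (posnP d) => [d0|d_gt0].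
    have -> : ph 1 = 0 by move: phi0; rewrite [X in split_phi _ _ _ _ X.+1]d0.
    by rewrite !scale0r.
  by rewrite trLX_evS // theta_altseq /altseq expr1 mulN1r.
pose r i := chain (s *: B^T) (altseq be') (ev C d 0) i.
have rA : forall i, A^T *m r i.+1 = altseq al i.+1 *: r i.+1 + ph' i.+1 *: r i.
  apply: (chain_up rel') => //.
  rewrite -scalemxAl eB // -scalemxAr mulmxDr -!scalemxAr eA1 eA0 -/ph'.
  have e0 : altseq be 0 = be by rewrite /altseq expr0 mul1r addr0.
  rewrite e0 [ph' 1 + _]addrC -ebase -/ph.
  by apply/matrixP=> x y; rewrite !mxE; ring.
pose co i (v : 'cV[C]_d.+1) := (ev C d i)^T *m v.
have coP v : (forall i, (i <= d)%N -> co i v = 0) -> v = 0.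
  move=> v0; apply: trmx_inj; rewrite trmx0; apply: eq_mulmx_ev => i le_id.
  by apply: trmx_inj; rewrite trmx_mul trmxK mul0mx trmx0; apply: v0.
have coB v i : (i <= d)%N -> co i (B *m v) = altseq be i *: co i v + ph i.+1 *: co i.+1 v.
  move=> le_id; rewrite /co !scalemxAl -mulmxDl mulmxA; congr (_ *m _).
  by apply: trmx_inj; rewrite trmx_mul trmxK eB // linearD !linearZ /= !trmxK.
(* The factors of the chain use the diagonal entries of [B] from the last one upwards. After [k] of
   them the last [k] coordinates vanish, so at [k = d] only coordinate 0 is left. *)
have chain_top v k i : (d < i + k)%N -> co i (chain (s *: B) (altseq be') v k) = 0.
  elim: k i => [|k IHk] i lt_d.
    by rewrite /co ev_gt ?trmx0 ?mul0mx //; rewrite addn0 in lt_d.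
  have [le_id|lt_di] := leqP i d; last by rewrite /co ev_gt ?trmx0 ?mul0mx.
  rewrite [chain _ _ _ _]/= /co mulmxBr -scalemxAl -!scalemxAr -!/(co i _) coB //.
  rewrite (IHk i.+1) ?addSnnS // scaler0 addr0.
  move: lt_d; rewrite addnS ltnS leq_eqVlt => /predU1P[ed|/IHk->]; last first.
    by rewrite !scaler0 subrr.
  have -> : i = (d - k)%N by lia.
  rewrite altseq_rev ?scalerA; last by lia.
  by rewrite mulrA -/s -expr2 s2 mul1r subrr.
move=> S S0 Slin SA SB.
have SZ c v : S v -> S (c *: v) by move=> Sv; rewrite -[_ *: _]addr0; apply: Slin.
have Schain v th k : S v -> S (chain (s *: B) th v k).
  move=> Sv; elim: k => //= k IHk.
  by rewrite addrC -scaleNr -scalemxAl; apply: Slin => //; apply/SZ/SB.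
have [[v [Sv nz_rv]]|none] := classic (exists v, S v /\ (r d)^T *m v <> 0).
  right.
  have Se0 : S (ev C d 0).
    set w := chain (s *: B) (altseq be') v d; pose c := co 0 w 0 0.
    have e_rv : (r d)^T *m v = co 0 w.
      by rewrite /r -[s *: B^T]linearZ /= chain_tr.
    have nz_c : c != 0.
      apply: contra_notN nz_rv => /eqP c0; rewrite e_rv.
      by apply/matrixP=> x y; rewrite !ord1 [LHS]c0 mxE.
    have ew : w = c *: ev C d 0.
      apply: trmx_inj; apply: eq_mulmx_ev => i le_id.
      have tco x : x^T *m ev C d i = (co i x)^T by rewrite /co trmx_mul trmxK.
      rewrite !tco; congr _^T; rewrite /co -scalemxAr -/(co i w).
      case: i le_id {tco} => [|i] le_id.
        apply/matrixP=> x y; rewrite !ord1 -/c !mxE (bigD1 ord0) //= !mxE big1 ?addr0.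
          by rewrite eqxx !mulr1.
        by move=> k nz_k; rewrite !mxE (negPf (nz_k : (k != 0 :> nat))) mul0r.
      rewrite chain_top ?addSn ?ltnS ?leq_addl //.
      apply/matrixP=> x y; rewrite !mxE big1 ?mulr0 // => k _; rewrite !mxE.
      by case: eqP => [->|_]; rewrite ?mul0r ?mulr0.
    by rewrite -[ev C d 0](scalerK nz_c) -ew; apply/SZ/Schain.
  have Se i : S (ev C d i).
    elim: i => // i IHi.
    have -> : ev C d i.+1 = - theta d a i *: ev C d i + A *m ev C d i.
      by rewrite LX_ev scaleNr addKr.
    by apply: Slin => //; apply: SA.
  move=> x; have -> : x = \sum_i x i 0 *: ev C d i.
    apply/matrixP=> i y; rewrite ord1 summxE (bigD1 i) //= big1 ?addr0.
      by rewrite !mxE eqxx mulr1.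
    by move=> k ne_ki; rewrite !mxE eq_sym (negPf (ne_ki : (k != i :> nat))) mulr0.
  by elim/big_rec: _ => // i y _ Sy; apply: Slin.
left=> v Sv.
have r0 k : (k <= d)%N -> forall w, S w -> (r (d - k)%N)^T *m w = 0.
  elim: k => [_ w Sw|k IHk lt_kd w Sw].
    by rewrite subn0; apply: NNPP => nz; apply: none; exists w.
  have ek : (d - k = (d - k.+1).+1)%N by lia.
  have := IHk (ltnW lt_kd) _ (SA _ Sw); rewrite mulmxA -[A]trmxK -trmx_mul ek rA.
  rewrite -ek linearD !linearZ /= mulmxDl -!scalemxAl IHk ?(ltnW lt_kd) //.
  rewrite scaler0 add0r => /eqP; rewrite scaler_eq0 => /predU1P[|/eqP //].
  by move/eqP; rewrite (negPf (nz_phi' _ _)) //; lia.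
(* [r 0] is coordinate 0. Since the superdiagonal of [B] has no zero, stability under [B] carries
   the vanishing from each coordinate to the next. *)
have co0 i : (i <= d)%N -> forall w, S w -> co i w = 0.
  elim: i => [_ w Sw|i IHi lt_id w Sw].
    by have := r0 d (leqnn d) w Sw; rewrite subnn.
  have := IHi (ltnW lt_id) _ (SB _ Sw); rewrite coB ?(ltnW lt_id) //.
  rewrite IHi ?(ltnW lt_id) // scaler0 add0r => /eqP; rewrite scaler_eq0.
  by rewrite (negPf (nz_ph _ _)) // => /eqP.
by apply: coP => i le_id; apply: co0.
Qed.

End SplitIrreducible.

(** * Recognizing a split module from one eigenvector *)

Section SplitIso.
Variable C : numClosedFieldType.
Implicit Types (al be ro ta ka la mu : C).

(** On [u] the first relation reads [D u = - A u + (s - ka) u], so trading [A] for the third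
    generator preserves both starting conditions. *)
Lemma chain_base_swap d (A B D : 'M[C]_d.+1) be ka la mu s (u : 'cV_d.+1) :
  BIrel A B D ka la mu -> B *m u = be *: u ->
  B *m (A *m u) = - (be + 1) *: (A *m u) + s *: u ->
  B *m (D *m u) = - (be + 1) *: (D *m u) + ((s - ka) * (2 * be + 1) - s) *: u.
Proof.
case=> h _ _ Bu BAu.
have Du : D *m u = - (A *m u) + (s - ka) *: u.
  have -> : D = anticomm A B - ka%:M by rewrite h addrK.
  rewrite mulmxBl mul_scalar_mx mulmxDl -!mulmxA Bu BAu -scalemxAr.
  by apply/matrixP=> i j; rewrite !mxE; ring.
rewrite Du mulmxDr mulmxN -scalemxAr BAu Bu.
by apply/matrixP=> i j; rewrite !mxE; ring.
Qed.

(** With [B] as the repeated operator, the cubic relation at [u] factors as [(B - (1 - be)) (B + be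
    + 1) A u = (2 ka be + la) u]. The first factor is injective by hypothesis and acts on [u] as
    [2 be - 1], so it can be cancelled. *)
Lemma chain_base_spectrum d (A B D : 'M[C]_d.+1) be ka la mu (u : 'cV_d.+1) :
  BIrel A B D ka la mu -> B *m u = be *: u -> 2 * be != 1 ->
  (forall w : 'cV_d.+1, B *m w = (1 - be) *: w -> w = 0) ->
  B *m (A *m u) = - (be + 1) *: (A *m u) + ((2 * ka * be + la) / (2 * be - 1)) *: u.
Proof.
move=> rel Bu nz_be noeig.
have := BIrel_cubic u (BIrel_rot (BIrel_swap rel)).
rewrite !(Bu, =^~ scalemxAr) => cub.
pose c := (2 * ka * be + la) / (2 * be - 1).
have nz2 : 2 * be - 1 != 0 by rewrite subr_eq0.
suff /subr0_eq <- : B *m (A *m u) + (be + 1) *: (A *m u) - c *: u = 0.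
  by rewrite scaleNr addrC addrK.
apply: noeig; rewrite mulmxBr mulmxDr -!scalemxAr Bu.
apply/matrixP=> i j; move/matrixP/(_ i j): cub; rewrite !mxE => h.
apply: (@eq_by_multiple _ 1 _ _ _ _ h); rewrite /c; field.
by rewrite nz2.
Qed.

(* The chain gives a nonzero, hence surjective, map from the split module. *)
Lemma split_iso d (A B D : 'M[C]_d.+1) ka la mu (u : 'cV_d.+1) (a b : C) ro ta phi s :
  let al := a - d%:R / 2 in let be := b - d%:R / 2 in
  BIrel A B D ka la mu -> irreducible_pair A B -> u != 0 -> B *m u = be *: u ->
  B *m (A *m u) = - (be + 1) *: (A *m u) + s *: u ->
  s = split_phi al be ro ta 1 + al * (2 * be + 1) ->
  ka = split_kappa al be ro ta -> mu = split_mu al be ro ta ->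
  (forall i, (0 < i <= d)%N -> phi i = split_phi al be ro ta i) ->
  split_phi al be ro ta d.+1 = 0 ->
  (forall w : 'cV_d.+1, B *m w = altseq be d.+1 *: w -> w = 0) ->
  exists2 P : 'M[C]_d.+1, P \in unitmx &
    [/\ A *m P = P *m LX d a, B *m P = P *m LY d b phi
      & D *m P = P *m (anticomm (LX d a) (LY d b phi) - ka%:M)].
Proof.
move=> al be rel irr nz_u Bu BAu es eka emu eqphi phi0 noeig.
rewrite (LYE b eqphi); set A' := LX d a; set B' := LY d b _.
rewrite es in BAu; pose v := chain A (altseq al) u; rewrite eka emu in rel *.
have Bv i : B *m v i.+1 = altseq be i.+1 *: v i.+1 + split_phi al be ro ta i.+1 *: v i.
  exact: (chain_up rel Bu BAu).
have Av i : A *m v i = altseq al i *: v i + v i.+1 by apply: chainS.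
(* As the entry at [d.+1] vanishes, [v d.+1] would be an eigenvector of [B] for an excluded
   eigenvalue. *)
have v_top : v d.+1 = 0 by apply: noeig; rewrite Bv phi0 scale0r addr0.
have v_gt i : (d < i)%N -> v i = 0.
  move=> lt_di; rewrite -(subnK lt_di); elim: (i - _)%N => // k IHk.
  by rewrite addSn /v /= -/(v _) IHk mulmx0 scaler0 subrr.
pose P := \matrix_(r < d.+1, c < d.+1) v c r 0.
have Pev i : P *m ev C d i = v i.
  have [lt_di|le_id] := ltnP d i; first by rewrite ev_gt ?v_gt ?mulmx0.
  rewrite (mulmx_ev _ (Ordinal (le_id : (i < d.+1)%N))).
  by apply/matrixP=> r j; rewrite !mxE ord1.
have AP : A *m P = P *m A'.
  apply: eq_mulmx_ev => i _; rewrite -!mulmxA LX_ev Pev Av.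
  by rewrite mulmxDr -scalemxAr !Pev theta_altseq.
have BP : B *m P = P *m B'.
  apply: eq_mulmx_ev => -[|i] _; rewrite -!mulmxA Pev.
    by rewrite LY_ev0 -scalemxAr Pev theta_altseq Bu /altseq expr0 mul1r addr0.
  by rewrite LY_evS // Bv mulmxDr -!scalemxAr !Pev theta_altseq.
have DP : D *m P = P *m (anticomm A' B' - (split_kappa al be ro ta)%:M).
  have [h _ _] := rel.
  have -> : D = anticomm A B - (split_kappa al be ro ta)%:M by rewrite h addrK.
  rewrite mulmxBl mulmxBr mul_scalar_mx mul_mx_scalar /anticomm mulmxDl mulmxDr.
  by rewrite -!mulmxA AP BP !mulmxA AP BP.
(* The left kernel of [P] annihilates its image, which is stable, contains [u], and is therefore the
   whole space. *)
exists P => //; rewrite -row_free_unit -kermx_eq0; apply/eqP/row_matrixP=> i.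
rewrite row0; apply/eqP; apply: contraTT isT => nz_k; exfalso.
pose S (w : 'cV[C]_d.+1) := exists x, w = P *m x.
have [] := irr S.
- by exists 0; rewrite mulmx0.
- move=> c _ _ [x ->] [y ->]; exists (c *: x + y).
  by rewrite mulmxDr scalemxAr.
- by move=> _ [x ->]; exists (A' *m x); rewrite !mulmxA AP.
- by move=> _ [x ->]; exists (B' *m x); rewrite !mulmxA BP.
- move=> /(_ u) S0; case/eqP: nz_u; apply: S0.
  by exists (ev C d 0); rewrite Pev.
move=> full; case/eqP: nz_k; apply/rowP=> j.
have [x ex] := full (ev C d j).
have : row i (kermx P) *m ev C d j = 0.
  by rewrite ex mulmxA -row_mul mulmx_ker row0 mul0mx.
by rewrite mulmx_ev => /matrixP/(_ 0 0); rewrite !mxE.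
Qed.

End SplitIso.

(** * The modules E_d and O_d *)

Section EOModules.
Variable C : numClosedFieldType.
Implicit Types (a b c : C).

(** [A] is recovered as [{B,D} - la]. *)
Lemma irreducible_pair_third d (A B D : 'M[C]_d.+1) ka la mu :
  BIrel A B D ka la mu -> irreducible_pair A B -> irreducible_pair D B.
Proof.
case=> _ h _ irr S S0 Slin SD SB; apply: irr => // v Sv.
have -> : A = anticomm B D - la%:M by rewrite h addrK.
rewrite mulmxBl mul_scalar_mx addrC -scaleNr; apply: (Slin) => //.
rewrite /anticomm mulmxDl -!mulmxA -[B *m _]scale1r.
by apply: Slin; [apply/SB/SD | apply/SD/SB].
Qed.

Lemma mod_isoI m (W W' : 'I_3 -> 'M[C]_m) P : P \in unitmx ->
  (forall g, W g *m P = P *m W' g) -> mod_iso W W'.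
Proof.
move=> uP eP; exists (invmx P) => [|g]; first by rewrite unitmx_inv.
by rewrite -[LHS](mulmxK uP) -[_ *m W g *m P]mulmxA eP mulKmx.
Qed.

Lemma split_base d a b phi : phi d.+1 = 0 ->
  let al := a - d%:R / 2 in let be := b - d%:R / 2 in
  LY d b phi *m (LX d a *m ev C d 0) =
  - (be + 1) *: (LX d a *m ev C d 0) + (phi 1 + al * (2 * be + 1)) *: ev C d 0.
Proof.
move=> phi0 al be; rewrite LX_ev mulmxDr -scalemxAr LY_ev0 LY_evS //.
rewrite !theta_altseq -/al -/be /altseq expr0 expr1.
by apply/matrixP=> i j; rewrite !mxE; ring.
Qed.

Definition gE d a b : C := a + b - (d%:R + 1) / 2.

Lemma phiE_split d a b c i : (i <= d)%N ->
  phiE d a b c i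
  = split_phi (a - d%:R / 2) (b - d%:R / 2) (- (c + gE d a b)) (c - gE d a b) i.
Proof.
move=> le_id; rewrite /phiE /split_phi /gE if_neg; case: ifP => _; first by field.
by rewrite natrM natrD natrB //; field.
Qed.

(** For odd [d] the index [d + 1] is even and the implied third parameter is the root; for [O_d] the
    index is odd and the root is [ro]. This parity separates the two families. *)
Lemma phiE_split_top d a b c : odd d ->
  split_phi (a - d%:R / 2) (b - d%:R / 2) (- (c + gE d a b)) (c - gE d a b) d.+1 = 0.
Proof. by move=> odd_d; rewrite /split_phi /gE /= odd_d /= -addn1 natrD; field. Qed.

Lemma kappaE d a b c : c ^+ 2 - a ^+ 2 - b ^+ 2 + (d%:R + 1) ^+ 2 / 4
  = split_kappa (a - d%:R / 2) (b - d%:R / 2) (- (c + gE d a b)) (c - gE d a b).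
Proof. by rewrite /split_kappa /gE; field. Qed.

Lemma Emod_BIrel d a b c : odd d ->
  let al := a - d%:R / 2 in let be := b - d%:R / 2 in
  let ro := - (c + gE d a b) in let ta := c - gE d a b in
  BIrel (Emod d a b c i1) (Emod d a b c i2) (Emod d a b c i3)
    (split_kappa al be ro ta) (split_mu be al ro ta) (split_mu al be ro ta).
Proof.
move=> odd_d al be ro ta; rewrite /Emod /= kappaE; apply: BIrel_split.
  by move=> i /andP[_ le_id]; apply: phiE_split.
exact: phiE_split_top.
Qed.

(** Reversing the spectrum of [Y] negates [b], and for odd [d] no sign appears, so the dual data are
    those of [E_d(a,-b,c)]. *)
Lemma Emod_irreducible d a b c : odd d ->
  (forall i, (0 < i <= d)%N -> phiE d a b c i != 0) ->
  (forall i, (0 < i <= d)%N -> phiE d a (- b) c i != 0) ->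
  irreducible_pair (Emod d a b c i1) (Emod d a b c i2).
Proof.
move=> odd_d nz nz'; rewrite /Emod /=.
apply: (@split_irreducible C d a b (- (c + gE d a b)) (c - gE d a b) _
         (- (c + gE d a (- b))) (c - gE d a (- b))) => //.
- by move=> i /andP[_ le_id]; apply: phiE_split.
- exact: phiE_split_top.
- by rewrite -signr_odd /= odd_d expr0 /split_kappa /gE; field.
- by rewrite /split_mu /gE; field.
- by rewrite -signr_odd /= odd_d expr0 /split_phi /= /gE; field.
move=> i lt_i; have := nz' i lt_i; rewrite phiE_split; last by case/andP: lt_i.
by rewrite split_phiC; congr (split_phi _ _ _ _ _ != 0); field.
Qed.

(** The target starts at the other end of the spectrum of [Y], hence [-b], and is lowered by [Z],
    hence the exchange of [a] and [c]. The starting eigenvector is not explicit. The value [1 - be]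
    must be avoided for [chain_base_spectrum], and [be + d + 1] for the chain to stop. *)
Lemma Emod_iso d a b c : odd d ->
  irreducible_pair (Emod d a b c i1) (Emod d a b c i2) ->
  let be := - b - d%:R / 2 in 2 * be != 1 ->
  (forall i, (i <= d)%N -> theta d b i != 1 - be) ->
  (forall i, (i <= d)%N -> theta d b i != be + d%:R + 1) ->
  exists2 P : 'M[C]_d.+1, P \in unitmx &
   [/\ Emod d a b c i3 *m P = P *m Emod d c (- b) a i1,
       Emod d a b c i2 *m P = P *m Emod d c (- b) a i2
     & Emod d a b c i1 *m P = P *m Emod d c (- b) a i3].
Proof.
move=> odd_d irr be nz_be ne1 ne2.
have rel := BIrel_swap (Emod_BIrel a b c odd_d).
have irr' := irreducible_pair_third (BIrel_swap rel) irr.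
have [u nz_u Yu] := LY_eigenvector b (phiE d a b c) (leqnn d).
have {Yu} Yu : Emod d a b c i2 *m u = be *: u.
  rewrite /Emod /= Yu theta_altseq /altseq -signr_odd odd_d expr1.
  by congr (_ *: _); rewrite /be; field.
have nz2 : 2 * be - 1 != 0 by rewrite subr_eq0.
have base := chain_base_spectrum rel Yu nz_be (fun w => @LY_eigen0 C d b _ _ w ne1).
have [||||||P uP [e1 e2 e3]] := @split_iso C d _ _ _ _ _ _ u c (- b)
    (- (a + gE d c (- b))) (a - gE d c (- b)) (phiE d c (- b) a)
    _ rel irr' nz_u Yu base.
- rewrite /split_phi /split_kappa /split_mu /gE /be /=; field.
  by rewrite (_ : _ - 1 = 2 * be - 1) // /be; field.
- by rewrite /split_kappa /split_mu /gE; field.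
- by rewrite /split_mu /gE; field.
- by move=> i /andP[_ le_id]; apply: phiE_split.
- exact: phiE_split_top.
- move=> w; apply: LY_eigen0 => i le_id; rewrite /altseq -signr_odd /= odd_d expr0.
  by rewrite mul1r -/be -addn1 natrD addrA ne2.
exists P => //; split; rewrite ?e1 ?e2 ?e3 //; congr (_ *m (_ - _%:M)).
by rewrite kappaE /split_kappa /split_mu /gE; field.
Qed.

Definition taO d a b c : C := (d%:R + 1) / 2 - a - b + c.

Lemma phiO_split d a b c i :
  phiO d a b c i
  = split_phi (a - d%:R / 2) (b - d%:R / 2) (d%:R + 1) (taO d a b c) i.
Proof. by rewrite /phiO /split_phi /taO if_neg; case: ifP => _; field. Qed.

Lemma phiO_split_top d a b c : ~~ odd d ->
  split_phi (a - d%:R / 2) (b - d%:R / 2) (d%:R + 1) (taO d a b c) d.+1 = 0.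
Proof. by move=> even_d; rewrite /split_phi /= even_d -addn1 natrD subrr mul0r. Qed.

Lemma kappaO d a b c : 2 * a * b - c * (d%:R + 1)
  = split_kappa (a - d%:R / 2) (b - d%:R / 2) (d%:R + 1) (taO d a b c).
Proof. by rewrite /split_kappa /taO; field. Qed.

Lemma Omod_BIrel d a b c : ~~ odd d ->
  let al := a - d%:R / 2 in let be := b - d%:R / 2 in
  let ro := d%:R + 1 in let ta := taO d a b c in
  BIrel (Omod d a b c i1) (Omod d a b c i2) (Omod d a b c i3)
    (split_kappa al be ro ta) (split_mu be al ro ta) (split_mu al be ro ta).
Proof.
move=> even_d al be ro ta; rewrite /Omod /= kappaO; apply: BIrel_split.
  by move=> i _; apply: phiO_split.
exact: phiO_split_top.
Qed.

(** For even [d] the reversal costs a sign, so the dual data are those of [O_d(a,-b,-c)]. *)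
Lemma Omod_irreducible d a b c : ~~ odd d ->
  (forall i, (0 < i <= d)%N -> phiO d a b c i != 0) ->
  (forall i, (0 < i <= d)%N -> phiO d a (- b) (- c) i != 0) ->
  irreducible_pair (Omod d a b c i1) (Omod d a b c i2).
Proof.
move=> even_d nz nz'; rewrite /Omod /=.
apply: (@split_irreducible C d a b (d%:R + 1) (taO d a b c) _
         (d%:R + 1) (taO d a (- b) (- c))) => //.
- by move=> i _; apply: phiO_split.
- exact: phiO_split_top.
- by rewrite -signr_odd /= even_d expr1 /split_kappa /taO; field.
- by rewrite /split_mu /taO; field.
- by rewrite -signr_odd /= even_d expr1 /split_phi /= /taO; field.
move=> i lt_i; have := nz' i lt_i; rewrite phiO_split.
by rewrite split_phiC; congr (split_phi _ _ _ _ _ != 0); field.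
Qed.

(** The starting vector [ev 0] is kept and [X] is traded for [Z]. The excluded value is the one that
    would follow the last eigenvalue of [Y]. *)
Lemma Omod_iso13 d a b c : ~~ odd d ->
  irreducible_pair (Omod d a b c i1) (Omod d a b c i2) ->
  (forall i, (i <= d)%N -> theta d b i != - (b + d%:R / 2 + 1)) ->
  exists2 P : 'M[C]_d.+1, P \in unitmx &
   [/\ Omod d a b c i3 *m P = P *m Omod d c b a i1,
       Omod d a b c i2 *m P = P *m Omod d c b a i2
     & Omod d a b c i1 *m P = P *m Omod d c b a i3].
Proof.
move=> even_d irr ne.
have rel := Omod_BIrel a b c even_d.
have irr' := irreducible_pair_third rel irr.
have nz_u : ev C d 0 != 0.
  by apply/eqP=> /matrixP/(_ 0 0); rewrite !mxE /= => /eqP; rewrite oner_eq0.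
have Yu : Omod d a b c i2 *m ev C d 0 = (b - d%:R / 2) *: ev C d 0.
  by rewrite /Omod /= LY_ev0 theta_altseq /altseq expr0 mul1r addr0.
have phi0 : phiO d a b c d.+1 = 0 by rewrite phiO_split phiO_split_top.
have base := chain_base_swap rel Yu (split_base a b phi0).
have [||||||P uP [e1 e2 e3]] := @split_iso C d _ _ _ _ _ _ (ev C d 0) c b
    (d%:R + 1) (taO d c b a) (phiO d c b a)
    _ (BIrel_swap rel) irr' nz_u Yu base.
- by rewrite phiO_split /split_phi /split_kappa /taO /=; field.
- by rewrite /split_kappa /split_mu /taO; field.
- by rewrite /split_mu /taO; field.
- by move=> i _; apply: phiO_split.
- exact: phiO_split_top.
- move=> w; apply: LY_eigen0 => i le_id; rewrite /altseq -signr_odd /= even_d expr1.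
  rewrite mulN1r (_ : _ + _ = b + d%:R / 2 + 1) ?ne //.
  by rewrite -addn1 natrD; field.
exists P => //; split; rewrite ?e1 ?e2 ?e3 //; congr (_ *m (_ - _%:M)).
by rewrite kappaO /split_kappa /split_mu /taO; field.
Qed.

(** Each factor pushes the highest nonzero coordinate up by one and multiplies it by [s], whatever
    [th] is. *)
Lemma LX_chain_neq0 d a s th i : s != 0 -> (i <= d)%N ->
  chain (s *: LX d a) th (ev C d 0) i != 0.
Proof.
move=> nz_s le_id; pose x := chain (s *: LX d a) th (ev C d 0).
pose co j (v : 'cV[C]_d.+1) := (ev C d j)^T *m v.
have coA j v : (j < d)%N ->
    co j.+1 (LX d a *m v) = theta d a j.+1 *: co j.+1 v + co j v.
  move=> lt_jd; rewrite /co scalemxAl -mulmxDl mulmxA; congr (_ *m _).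
  by apply: trmx_inj; rewrite trmx_mul trmxK trLX_evS // linearD linearZ /= !trmxK.
suff xi k : (k <= d)%N -> (forall j, (k < j <= d)%N -> co j (x k) = 0) /\
    co k (x k) = (s ^+ k)%:M.
  have [_ e] := xi i le_id; apply/eqP => x0; move: e; rewrite /x x0 /co mulmx0.
  by move/matrixP/(_ 0 0)/eqP; rewrite !mxE /= eq_sym mulr1n expf_eq0 (negPf nz_s) andbF.
elim: k => [_|k IHk lt_kd]; last have [IH0 IH1] := IHk (ltnW lt_kd).
  split=> [j /andP[j_gt0 _]|]; apply/matrixP=> p q; rewrite !ord1 !mxE.
    rewrite big1 // => l _; rewrite !mxE.
    case: eqP => [->|_]; last by rewrite mul0r.
    by rewrite (gtn_eqF j_gt0) mulr0.
  rewrite (bigD1 ord0) //= !mxE big1 ?addr0 ?eqxx ?mulr1 //.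
  by move=> l nz_l; rewrite !mxE (negPf (nz_l : (l != 0 :> nat))) mul0r.
have step j : (k < j.+1 <= d)%N -> co j.+1 (x k.+1) = s *: co j (x k).
  move=> lt_j; rewrite /x /= -/(x k) /co mulmxBr -scalemxAl -!scalemxAr -!/(co _ _).
  have /andP[_ lt_jd] := lt_j.
  by rewrite coA // IH0 // !scaler0 subr0 add0r.
split=> [[//|j] /andP[lt_kj lt_jd]|].
  rewrite step; last by lia.
  by rewrite IH0 ?scaler0 //; lia.
by rewrite step ?leqnn ?lt_kd // IH1 scale_scalar_mx exprS.
Qed.

(* Reversing the chain of X turns its last vector into an X-eigenvector with
   the eigenvalue from which the target module starts. *)
Lemma Omod_iso132 d a b c : ~~ odd d ->
  irreducible_pair (Omod d a b c i1) (Omod d a b c i2) ->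
  (forall i, (i <= d)%N -> theta d b i != - (b + d%:R / 2 + 1)) ->
  (forall i, (i <= d)%N -> theta d a i != - (a + d%:R / 2 + 1)) ->
  exists2 P : 'M[C]_d.+1, P \in unitmx &
   [/\ Omod d a b c i3 *m P = P *m Omod d c a b i1,
       Omod d a b c i1 *m P = P *m Omod d c a b i2
     & Omod d a b c i2 *m P = P *m Omod d c a b i3].
Proof.
move=> even_d irr neb nea.
have rel := Omod_BIrel a b c even_d.
have N1 : (-1 : C) ^+ 2 = 1 by rewrite sqrrN expr1n.
have := BIrel_sign N1 rel.
set X := Omod d a b c i1; set Y := Omod d a b c i2; set Z := Omod d a b c i3.
pose al := a - d%:R / 2; pose be := b - d%:R / 2.
(* Negating [X] and [Z] turns the constants of [O_d(a,b,c)] into those of [O_d(-a,b,-c)], whose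
   lowering spectrum is that of [-X] in reverse order. *)
pose al' := - a - d%:R / 2; pose ta' := taO d (- a) b (- c).
have -> : -1 * split_kappa al be (d%:R + 1) (taO d a b c)
    = split_kappa al' be (d%:R + 1) ta'.
  by rewrite /split_kappa /al /al' /be /ta' /taO; field.
have -> : split_mu al be (d%:R + 1) (taO d a b c)
    = split_mu al' be (d%:R + 1) ta'.
  by rewrite /split_mu /al /al' /be /ta' /taO; field.
move=> rel'.
have Ye0 : Y *m ev C d 0 = be *: ev C d 0.
  by rewrite /Y /Omod /= LY_ev0 theta_altseq /altseq expr0 mul1r addr0.
pose v := chain (-1 *: X) (altseq al') (ev C d 0).
have phi0 : phiO d a b c d.+1 = 0 by rewrite phiO_split phiO_split_top.
pose ph i := split_phi al' be (d%:R + 1) ta' i.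
have Yv : forall i, Y *m v i.+1 = altseq be i.+1 *: v i.+1 + ph i.+1 *: v i.
  apply: (chain_up rel' Ye0).
  rewrite -!scalemxAl -!scalemxAr [Y *m _](split_base a b phi0) -/al -/be.
  rewrite phiO_split /split_phi /= /al' /al /be /ta' /taO.
  by apply/matrixP=> x y; rewrite !mxE; field.
have Xv i : X *m v i = - altseq al' i *: v i - v i.+1.
  have := chainS (-1 *: X) (altseq al') (ev C d 0) i; rewrite -/(v _) -/(v i.+1).
  by rewrite -scalemxAl scaleN1r scaleNr -opprD => <-; rewrite opprK.
have v_top : v d.+1 = 0.
  apply: (@LY_eigen0 C d b (altseq be d.+1) (phiO d a b c)) => [i le_id|].
    rewrite /altseq -signr_odd /= even_d expr1 mulN1r -addn1 natrD.
    by rewrite (_ : _ + _ = b + d%:R / 2 + 1) ?neb // /be; field.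
  by rewrite [LHS]Yv /ph phiO_split_top // scale0r addr0.
have nz_u : v d != 0 by apply: LX_chain_neq0; rewrite ?oppr_eq0 ?oner_eq0.
have Xu : X *m v d = al *: v d.
  rewrite Xv v_top subr0 /altseq -signr_odd (negPf even_d) expr0.
  by congr (_ *: _); rewrite /al /al'; field.
have ed : altseq be d = be + d%:R.
  by rewrite /altseq -signr_odd (negPf even_d) expr0 mul1r.
have base0 : X *m (Y *m v d) = - (al + 1) *: (Y *m v d)
    + ((be + d%:R) * (2 * al + 1) - ph d) *: v d.
  (* For [d = 0] the last vector has no predecessor, and [ph d] vanishes. *)
  case: (posnP d) => [d0|d_gt0].
    have e0 : ph d = 0 by rewrite /ph [X in split_phi _ _ _ _ X]d0 /split_phi mul0r.
    have ev0 : v d = ev C d 0 by rewrite [X in v X]d0.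
    have d0' : d%:R = 0 :> C by rewrite d0.
    rewrite e0 ev0 Ye0 -scalemxAr -ev0 Xu d0'.
    by apply/matrixP=> x y; rewrite !mxE; ring.
  have eS : d = d.-1.+1 by rewrite prednK.
  have := Yv d.-1; rewrite -eS ed => Yd.
  have Xd : X *m v d.-1 = - (al + 1) *: v d.-1 - v d.
    have od : odd d.-1 by move: even_d; rewrite {1}eS /= negbK.
    rewrite Xv prednK // /altseq -signr_odd od expr1; congr (_ *: _ - _).
    have -> : d.-1%:R = d%:R - 1 :> C by rewrite {2}eS -addn1 natrD addrK.
    by rewrite /al /al'; field.
  rewrite Yd mulmxDr -!scalemxAr Xu Xd.
  by apply/matrixP=> x y; rewrite !mxE; ring.
have relX := BIrel_rot (BIrel_swap rel).
have base := chain_base_swap relX Xu base0.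
have irrX : irreducible_pair Z X.
  apply: (irreducible_pair_third relX) => S S0 Slin SY SX; exact: irr.
have [||||||P uP [e1 e2 e3]] := @split_iso C d _ _ _ _ _ _ (v d) c a
    (d%:R + 1) (taO d c a b) (phiO d c a b)
    _ (BIrel_swap relX) irrX nz_u Xu base.
- by rewrite /ph /ta' /split_phi /split_kappa /taO (negPf even_d) /= /al /be /al'; field.
- by rewrite /split_kappa /split_mu /taO /al /be; field.
- by rewrite /split_mu /split_kappa /taO /al /be; field.
- by move=> i _; apply: phiO_split.
- exact: phiO_split_top.
- move=> w; apply: LX_eigen0 => i le_id; rewrite /altseq -signr_odd /= even_d expr1.
  rewrite mulN1r (_ : _ + _ = a + d%:R / 2 + 1) ?nea //.
  by rewrite -addn1 natrD; field.
exists P => //; split; rewrite ?e1 ?e2 ?e3 //; congr (_ *m (_ - _%:M)).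
by rewrite kappaO /split_kappa /split_mu /taO /al /be; field.
Qed.
End EOModules.

(** * Consequences of k_1 >= 0 for the parameters of the theorem *)

Lemma ord3_cases (g : 'I_3) : [\/ g = i1, g = i2 | g = i3].
Proof.
case: g => [[|[|[|//]]] lt_g]; [apply: Or31 | apply: Or32 | apply: Or33];
exact: val_inj.
Qed.

(* In the theorem t_2 = p + 1, t_3 = q + 1 and n = p + q + m + 2; for W_3 the
   roles of p and q are exchanged. *)
Section ParameterBounds.
Variables (C : numClosedFieldType) (k1 : C) (k1_ge0 : 0 <= k1).

Lemma shift_neq0 n : 2 * k1 + n.+1%:R != 0.
Proof. by rewrite lt0r_neq0 // ltr_wpDl ?ltr0Sn ?mulr_ge0 ?ler0n. Qed.

Lemma neq_by (x y z : C) : z != 0 -> (x - y = z \/ x - y = - z) -> x != y.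
Proof. by move=> nz [] e; rewrite -subr_eq0 e ?oppr_eq0. Qed.

Lemma natS_neq0 n : n.+1%:R != 0 :> C.
Proof. by rewrite pnatr_eq0. Qed.

Section EvenType.
Variables (p q m : nat).
(** This is [-K-n-1], and [c] is [k_3], after substituting [k_2 = -(p+1)/2] and [k_3 = -(q+1)/2]. *)
Let b : C := - k1 - (p + q)%:R / 2 - 2 - m%:R.
Let c : C := - q.+1%:R / 2.

Lemma phiO_neq0 i : (0 < i <= p)%N -> phiO p k1 b c i != 0.
Proof.
case/andP=> i_gt0 /subnK/esym; rewrite addnC; move: (p - i)%N => j ep.
have nz : i%:R * (j + q + 2 + m).+1%:R != 0 :> C.
  by rewrite mulf_neq0 ?natS_neq0 // pnatr_eq0 -lt0n.
have nz' : j.+1%:R * (j + 1 + m).+1%:R != 0 :> C.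
  by rewrite mulf_neq0 ?natS_neq0.
rewrite /phiO /b /c ep if_neg in nz nz' *; case: ifP => _.
  by apply: (neq_by nz'); right; field.
by apply: (neq_by nz); left; field.
Qed.

(** In [a + b] the parameter [k_1] cancels and leaves integer factors; in [a - b] it doubles, and
    [k_1 >= 0] keeps the factors nonzero. *)
Lemma phiO_flip_neq0 i : (0 < i <= p)%N -> phiO p k1 (- b) (- c) i != 0.
Proof.
case/andP=> i_gt0 /subnK/esym; rewrite addnC; move: (p - i)%N => j ep.
have nz : i%:R * (2 * k1 + (q + m + 1 + i).+1%:R) != 0 :> C.
  by rewrite mulf_neq0 ?shift_neq0 // pnatr_eq0 -lt0n.
have nz' : j.+1%:R * (2 * k1 + (m + i).+1%:R) != 0 :> C.
  by rewrite mulf_neq0 ?natS_neq0 ?shift_neq0.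
rewrite /phiO /b /c ep if_neg in nz nz' *; case: ifP => _.
  by apply: (neq_by nz'); left; field.
by apply: (neq_by nz); right; field.
Qed.

(** For even [p] the right side is the term of index [p + 1] of the same sequence. *)
Lemma theta_b_neq i : (i <= p)%N -> theta p b i != - (b + p%:R / 2 + 1).
Proof.
move/subnK/esym; rewrite addnC; move: (p - i)%N => j ep.
have nz := shift_neq0 (j + q + 2 + m + m).
have nz' := natS_neq0 j.
rewrite /theta /b ep -signr_odd in nz nz' *; case: (odd i).
  by rewrite expr1; apply: (neq_by nz'); left; field.
by rewrite expr0; apply: (neq_by nz); right; field.
Qed.

Lemma theta_k1_neq i : (i <= p)%N -> theta p k1 i != - (k1 + p%:R / 2 + 1).
Proof.
move/subnK/esym; rewrite addnC; move: (p - i)%N => j ep.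
have nz := shift_neq0 i; have nz' := natS_neq0 j.
rewrite /theta ep -signr_odd in nz nz' *; case: (odd i).
  by rewrite expr1; apply: (neq_by nz'); left; field.
by rewrite expr0; apply: (neq_by nz); left; field.
Qed.

Hypothesis even_p : ~~ odd p.

Lemma Omod_k1_irreducible :
  irreducible_pair (Omod p k1 b c i1) (Omod p k1 b c i2).
Proof.
apply: Omod_irreducible => // i lt_i; first exact: phiO_neq0.
exact: phiO_flip_neq0.
Qed.

Lemma Omod_twist13 :
  let W := twist_aut (fun=> 1) perm13 (Omod p k1 b c) in
  irreducible W /\ mod_iso W (Omod p c b k1).
Proof.
move=> W; split.
  apply: (irreducible_pairW (g := i3) (h := i2) (s := 1) (s' := 1) Omod_k1_irreducible);
  by rewrite /W /twist_aut !scale1r.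
have [P uP [e1 e2 e3]] := Omod_iso13 even_p Omod_k1_irreducible theta_b_neq.
apply: (mod_isoI uP) => g; rewrite /W /twist_aut scale1r.
have [->|->|->] : [\/ g = i1, g = i2 | g = i3] by apply: ord3_cases.
- exact: e1.
- exact: e2.
- exact: e3.
Qed.

Lemma Omod_twist132 :
  let W := twist_aut (fun=> 1) perm132 (Omod p k1 b c) in
  irreducible W /\ mod_iso W (Omod p c k1 b).
Proof.
move=> W; split.
  apply: (irreducible_pairW (g := i2) (h := i3) (s := 1) (s' := 1) Omod_k1_irreducible);
  by rewrite /W /twist_aut !scale1r.
have [P uP [e1 e2 e3]] :=
  Omod_iso132 even_p Omod_k1_irreducible theta_b_neq theta_k1_neq.
apply: (mod_isoI uP) => g; rewrite /W /twist_aut scale1r.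
have [->|->|->] : [\/ g = i1, g = i2 | g = i3] by apply: ord3_cases.
- exact: e1.
- exact: e2.
- exact: e3.
Qed.
End EvenType.

Section OddType.
Variables (p q m : nat).
Let N : C := (p + q + m + 3)%:R / 2.
Let a : C := k1 - q.+1%:R / 2 + N.
Let b : C := - k1 + p.+1%:R / 2 - N.

(** At odd [i] the difference of squares factors as [(p+i+1) (q+m-i+2)], with no trace of [k_1]. *)
Lemma phiE_neq0 i : (0 < i <= m)%N -> phiE m a b N i != 0.
Proof.
move=> lt_i; rewrite /phiE if_neg; case: ifP => _; last first.
  by rewrite pnatr_eq0 muln_eq0; lia.
have /andP[i_gt0 /subnK/esym] := lt_i; rewrite addnC; move: (m - i)%N => j em.
have nz : (p + i).+1%:R * (q + 1 + j).+1%:R != 0 :> C by rewrite mulf_neq0 ?natS_neq0.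
rewrite /a /b /N em in nz *.
by apply: (neq_by nz); left; field.
Qed.

Lemma phiE_flip_neq0 i : (0 < i <= m)%N -> phiE m a (- b) N i != 0.
Proof.
move=> lt_i; rewrite /phiE if_neg; case: ifP => _; last first.
  by rewrite pnatr_eq0 muln_eq0; lia.
have /andP[i_gt0 _] := lt_i.
have nz : (2 * k1 + i.-1.+1%:R) * (2 * k1 + (p + q + m + 2 + i).+1%:R) != 0.
  by rewrite mulf_neq0 ?shift_neq0.
rewrite prednK // /a /b /N in nz *.
by apply: (neq_by nz); right; field.
Qed.

Lemma Emod_k1_irreducible : odd m ->
  irreducible_pair (Emod m a b N i1) (Emod m a b N i2).
Proof.
move=> odd_m; apply: Emod_irreducible => // i lt_i; first exact: phiE_neq0.
exact: phiE_flip_neq0.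
Qed.

Lemma Emod_twist13 : odd m ->
  let W := twist_aut (sgn_mm C) perm13 (Emod m a b N) in
  irreducible W /\ mod_iso W (twist_aut (sgn_1m C) id (Emod m N (- b) a)).
Proof.
move=> odd_m W; have irr := Emod_k1_irreducible odd_m; split.
  by apply: (irreducible_pairW (g := i3) (h := i2) (s := -1) (s' := -1) irr);
    rewrite /W /twist_aut /= !scalerA mulrNN mulr1 scale1r.
have ebe : - b - m%:R / 2 = k1 + q%:R / 2 + 1.
  by rewrite /b /N; field.
have [|||P uP [e1 e2 e3]] := Emod_iso odd_m irr.
- have nz := shift_neq0 q; rewrite ebe; apply: (neq_by nz); left.
  by rewrite -addn1 natrD; field.
- move=> i /subnK/esym; rewrite addnC; move: (m - i)%N => j em.
  have nz := shift_neq0 (q + j); have nz' := natS_neq0 j.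
  rewrite /theta /b /N em -signr_odd in nz nz' *; case: (odd i).
    by rewrite expr1; apply: (neq_by nz); left; field.
  by rewrite expr0; apply: (neq_by nz'); right; field.
- move=> i /subnK/esym; rewrite addnC; move: (m - i)%N => j em.
  have nz := shift_neq0 (q + 2 + j + m); have nz' := natS_neq0 i.
  rewrite /theta /b /N em -signr_odd in nz nz' *; case: (odd i).
    by rewrite expr1; apply: (neq_by nz'); right; field.
  by rewrite expr0; apply: (neq_by nz); right; field.
apply: (mod_isoI uP) => g; rewrite /W /twist_aut.
have [->|->|->] : [\/ g = i1, g = i2 | g = i3] by apply: ord3_cases.
- by rewrite /= !scale1r e1.
- by rewrite /= -!scalemxAl -!scalemxAr e2.
- by rewrite /= -!scalemxAl -!scalemxAr e3.
Qed.
End OddType.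
End ParameterBounds.

(** * Coefficients of Dunkl operators *)

Section Coefficients.
Variable C : numClosedFieldType.
Implicit Types (f g : {mpoly C[3]}) (m : 'X_{1..3}) (i : 'I_3).

(* T_i x_i^n = dunkl_nat k_i n * x_i^(n-1) *)
Definition dunkl_nat (k : C) (n : nat) : C := n%:R + (if odd n then 2 * k else 0).

Lemma dunkl_nat0 k : dunkl_nat k 0 = 0.
Proof. by rewrite /dunkl_nat addr0. Qed.

(** The reflection term absorbs half of the jump [2 k] at odd [j]; this is what makes the diagonals
    of [Y] and [Z] alternating arithmetic sequences. *)
Lemma dunkl_nat_sign k k' j : (-1) ^+ j * (dunkl_nat k j + 2^-1 + k') + k =
  (-1) ^+ j * (j%:R + 2^-1 + k' + k).
Proof.
by rewrite /dunkl_nat -signr_odd; case: (odd j); rewrite ?expr0 ?expr1; ring.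
Qed.

Lemma mcoeff_refl i f m : (refl i f)@_m = (-1) ^+ m i * f@_m.
Proof.
rewrite /refl comp_mpolyEX raddf_sum [in RHS](mpolyE f) raddf_sum mulr_sumr /=.
apply: eq_bigr => m' _; rewrite !mcoeffZ mcoeffX mulrCA; congr (_ * _).
rewrite comp_mpolyX; have -> : \prod_(j < 3) tnth [tuple (if j == i then - 'X_j else 'X_j)
    | j < 3] j ^+ m' j = (-1) ^+ m' i *: 'X_[m'] :> {mpoly C[3]}.
  rewrite [in RHS]mpolyXE_id (bigD1 i) //= [in RHS](bigD1 i) //= tnth_mktuple eqxx.
  rewrite scalerAl; congr (_ * _).
    by rewrite [in LHS]exprNn -[in LHS]signr_odd mulr_sign -[in RHS]signr_odd scaler_sign.
  by apply: eq_bigr => j /negPf ne_ji; rewrite tnth_mktuple ne_ji.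
rewrite mcoeffZ mcoeffX; case: eqP => [->//|_]; by rewrite !mulr0.
Qed.

Lemma mcoeff_divX i f m : (divX i f)@_m = f@_(m + U_(i)).
Proof.
have eqU m' : (0 < m' i)%N -> (m' - U_(i) == m)%MM = (m' == m + U_(i))%MM.
  move=> m'i; apply/eqP/eqP => [<-|->]; last by rewrite addmK.
  rewrite submK //; apply/mnm_lepP=> j; rewrite mnm1E.
  by case: eqP => [<-|].
rewrite /divX raddf_sum /= big_mkcond.
rewrite (eq_bigr (fun m' => f@_m' * (m' == m + U_(i))%MM%:R)); last first.
  move=> m' _; case: ifP => m'i; first by rewrite mcoeffZ mcoeffX eqU.
  case: eqP => [em|_]; last by rewrite mulr0.
  by rewrite em mnmDE mnm1E eqxx addn1 in m'i.
have [in_f|nin_f] := boolP ((m + U_(i))%MM \in msupp f).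
  rewrite (bigD1_seq _ in_f) //= eqxx mulr1 big1 ?addr0 //.
  by move=> m' /negPf->; rewrite mulr0.
rewrite (memN_msupp_eq0 nin_f) big1_seq // => m' /andP[_ in_f].
by case: eqP => [em|_]; rewrite ?mulr0 //; rewrite -em in_f in nin_f.
Qed.

Lemma mcoeff_dunkl k i f m :
  (dunkl k i f)@_m = dunkl_nat (k i) (m i).+1 * f@_(m + U_(i)).
Proof.
rewrite /dunkl mcoeffD mcoeffZ mcoeff_deriv mcoeff_divX mcoeffB mcoeff_refl.
rewrite mnmDE mnm1E eqxx addn1 /dunkl_nat exprS -signr_odd /= -mulr_natl.
by case: (odd _) => /=; rewrite ?expr0 ?expr1; ring.
Qed.

Lemma mcoeff_mulXS i f m : ('X_i * f)@_(m + U_(i)) = f@_m.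
Proof. by rewrite mulrC addmC mcoeffMX. Qed.

Lemma mcoeff_mulX0 i f m : m i = 0%N -> ('X_i * f)@_m = 0.
Proof.
move=> mi; rewrite mcoeffM big1 // => -[k k'] /eqP em.
rewrite mcoeffX; case: eqP => [ek|_]; last by rewrite mul0r.
by move/mnmP/(_ i): em; rewrite mi mnmDE -ek mnm1E eqxx.
Qed.

Definition mon (a b c : nat) : 'X_{1..3} := [multinom nth 0%N [:: a; b; c] i | i < 3].

Lemma monE1 a b c : mon a b c i1 = a. Proof. by rewrite mnmE. Qed.
Lemma monE2 a b c : mon a b c i2 = b. Proof. by rewrite mnmE. Qed.
Lemma monE3 a b c : mon a b c i3 = c. Proof. by rewrite mnmE. Qed.

Lemma mon_eta m : m = mon (m i1) (m i2) (m i3).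
Proof.
by apply/mnmP=> i; case: (ord3_cases i) => ->; rewrite ?monE1 ?monE2 ?monE3.
Qed.

Lemma monU1 a b c : (mon a b c + U_(i1))%MM = mon a.+1 b c.
Proof.
apply/mnmP=> i; rewrite mnmDE mnm1E.
by case: (ord3_cases i) => ->; rewrite ?monE1 ?monE2 ?monE3 ?addn1 ?addn0.
Qed.

Lemma monU2 a b c : (mon a b c + U_(i2))%MM = mon a b.+1 c.
Proof.
apply/mnmP=> i; rewrite mnmDE mnm1E.
by case: (ord3_cases i) => ->; rewrite ?monE1 ?monE2 ?monE3 ?addn1 ?addn0.
Qed.

Lemma monU3 a b c : (mon a b c + U_(i3))%MM = mon a b c.+1.
Proof.
apply/mnmP=> i; rewrite mnmDE mnm1E.
by case: (ord3_cases i) => ->; rewrite ?monE1 ?monE2 ?monE3 ?addn1 ?addn0.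
Qed.

Lemma mdeg_mon a b c : mdeg (mon a b c) = (a + b + c)%N.
Proof. by rewrite mdegE !big_ord_recl big_ord0 !mnmE /= addn0 addnA. Qed.

(** * The operators in coordinates diagonalizing e_1 *)

Section Operators.
Variables k1 k2 k3 : C.
Local Notation k := (kfun k1 k2 k3).
Local Notation V := ({mpoly C[3]} * {mpoly C[3]})%type.
Implicit Types (v w : V) (s : C).

(* The coordinates of v along the eigenvectors of e_1 with eigenvalue s = 1, -1. *)
Definition co s v a b c : C := v.1@_(mon a b c) + s * v.2@_(mon a b c).

Lemma coE s v a b c : co s v a b c = v.1@_(mon a b c) + s * v.2@_(mon a b c).
Proof. by []. Qed.

Lemma co_lin s x v w a b c : co s (x *: v + w) a b c = x * co s v a b c + co s w a b c.
Proof. by rewrite /co /= !mcoeffD !mcoeffZ; ring. Qed.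

Lemma coD s v w a b c : co s (v + w) a b c = co s v a b c + co s w a b c.
Proof. by rewrite /co /= !mcoeffD; ring. Qed.

Lemma coZ s x v a b c : co s (x *: v) a b c = x * co s v a b c.
Proof. by rewrite /co /= !mcoeffZ; ring. Qed.

Lemma co_sig1 s v a b c : s ^+ 2 = 1 -> co s (sig i1 v) a b c = s * co s v a b c.
Proof. by move=> s2; rewrite /co /= mulrDr mulrA -expr2 s2 mul1r addrC. Qed.

(** [e_2], like [e_3] below, anticommutes with [e_1] and so exchanges its two eigenspaces. *)
Lemma co_sig2 s v a b c : s ^+ 2 = 1 ->
  co s (sig i2 v) a b c = 'i * s * co (- s) v a b c.
Proof.
move=> s2; rewrite /co /= !mcoeffZ.
transitivity ('i * s * v.1@_(mon a b c) - s ^+ 2 * 'i * v.2@_(mon a b c)); last by ring.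
by rewrite s2; ring.
Qed.

Lemma co_sig3 s v a b c : co s (sig i3 v) a b c = co (- s) v a b c.
Proof. by rewrite /co /= mcoeffN; ring. Qed.

Lemma co_vmap s F v a b c x m' : (forall f, (F f)@_(mon a b c) = x * f@_m') ->
  co s (vmap F v) a b c = x * (v.1@_m' + s * v.2@_m').
Proof. by move=> eF; rewrite /co /= !eF mulrDr [_ * (s * _)]mulrCA. Qed.

Lemma co_vmapB s F G v a b c :
  co s (vmap (fun f => F f - G f) v) a b c = co s (vmap F v) a b c - co s (vmap G v) a b c.
Proof. by rewrite /co /= !mcoeffB; ring. Qed.

Lemma co_refl s i v a b c :
  co s (vmap (refl i) v) a b c = (-1) ^+ (mon a b c i) * co s v a b c.
Proof. by apply: co_vmap => f; apply: mcoeff_refl. Qed.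

Lemma co_dunkl s i v a b c :
  co s (vmap (dunkl k i) v) a b c = dunkl_nat (k i) (mon a b c i).+1
    * (v.1@_(mon a b c + U_(i)) + s * v.2@_(mon a b c + U_(i))).
Proof. by apply: co_vmap => f; apply: mcoeff_dunkl. Qed.

Local Opaque co dunkl refl sig vmap angT dunkl_nat.

Lemma co_dirac s v a b c : s ^+ 2 = 1 ->
  co s (dirac k1 k2 k3 v) a b c =
    s * dunkl_nat k1 a.+1 * co s v a.+1 b c
    + 'i * s * dunkl_nat k2 b.+1 * co (- s) v a b.+1 c
    + dunkl_nat k3 c.+1 * co (- s) v a b c.+1.
Proof.
move=> s2; rewrite /dirac 2!coD; congr (_ + _ + _).
- by rewrite co_sig1 // co_dunkl monE1 monU1 mulrA.
- by rewrite co_sig2 // co_dunkl monE2 monU2 mulrA.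
by rewrite co_sig3 co_dunkl monE3 monU3.
Qed.

Let xT i j := vmap (fun f => 'X_i * dunkl k j f).

Lemma co_angT t i j w a b c :
  co t (angT k1 k2 k3 i j w) a b c = co t (xT i j w) a b c - co t (xT j i w) a b c.
Proof. exact: co_vmapB. Qed.

Lemma co_xT0 t i j w a b c : mon a b c i = 0%N -> co t (xT i j w) a b c = 0.
Proof.
move=> mi; rewrite /xT (co_vmap t w (x := 0) (m' := 0%MM)) ?mul0r // => f.
by rewrite mcoeff_mulX0 ?mul0r.
Qed.

Lemma co_x3T1 t w a b c :
  co t (xT i3 i1 w) a b c.+1 = dunkl_nat k1 a.+1 * co t w a.+1 b c.
Proof.
apply: co_vmap => f; rewrite -monU3 mcoeff_mulXS mcoeff_dunkl.
by rewrite monE1 monU1.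
Qed.

Lemma co_x2T1 t w a b c :
  co t (xT i2 i1 w) a b.+1 c = dunkl_nat k1 a.+1 * co t w a.+1 b c.
Proof.
apply: co_vmap => f; rewrite -monU2 mcoeff_mulXS mcoeff_dunkl.
by rewrite monE1 monU1.
Qed.

Lemma co_x3T2 t w a b c :
  co t (xT i3 i2 w) a b c.+1 = dunkl_nat k2 b.+1 * co t w a b.+1 c.
Proof.
apply: co_vmap => f; rewrite -monU3 mcoeff_mulXS mcoeff_dunkl.
by rewrite monE2 monU2.
Qed.

Lemma co_x2T3 t w a b c :
  co t (xT i2 i3 w) a b.+1 c = dunkl_nat k3 c.+1 * co t w a b c.+1.
Proof.
apply: co_vmap => f; rewrite -monU2 mcoeff_mulXS mcoeff_dunkl.
by rewrite monE3 monU3.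
Qed.

Lemma co_BI1 s v b c : s ^+ 2 = 1 ->
  co s (BIop k1 k2 k3 i1 v) 0 b c =
    'i * s * ((if c is c'.+1 then
                 dunkl_nat k2 b.+1 * ((-1) ^+ b.+1 * ((-1) ^+ c' * co s v 0 b.+1 c'))
               else 0)
            - (if b is b'.+1 then
                 dunkl_nat k3 c.+1 * ((-1) ^+ b' * ((-1) ^+ c.+1 * co s v 0 b' c.+1))
               else 0))
    + 2^-1 * ((-1) ^+ b * ((-1) ^+ c * co s v 0 b c))
    + k2 * ((-1) ^+ c * co s v 0 b c) + k3 * ((-1) ^+ b * co s v 0 b c).
Proof.
move=> s2; rewrite [BIop _ _ _ _ _]/BIop eqxx 3!coD; congr (_ + _ + _ + _).
- rewrite coZ co_sig1 // co_angT mulrA; congr (_ * (_ - _)).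
    case: c => [|c]; first by rewrite co_xT0 // monE3.
    by rewrite co_x3T2 2!co_refl monE2 monE3.
  case: b => [|b]; first by rewrite co_xT0 // monE2.
  by rewrite co_x2T3 2!co_refl monE2 monE3.
- by rewrite coZ 2!co_refl monE2 monE3.
- by rewrite coZ co_refl monE3.
by rewrite coZ co_refl monE2.
Qed.

(** At exponent 0 of [x_1] the term with [x_1 T_3] drops out, while [x_3 T_1] brings in the
    coefficient of [x_1], in the opposite eigenspace of [e_1]. *)
Lemma co_BI2 s v b c : s ^+ 2 = 1 ->
  co s (BIop k1 k2 k3 i2 v) 0 b c =
    (if c is c'.+1 then s * ((-1) ^+ c * (dunkl_nat k1 1 * co (- s) v 1 b c')) else 0)
    + 2^-1 * ((-1) ^+ c * co s v 0 b c)
    + k3 * co s v 0 b c + k1 * ((-1) ^+ c * co s v 0 b c).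
Proof.
move=> s2; rewrite [BIop _ _ _ _ _]/BIop (_ : (i2 == i1) = false) // eqxx 3!coD.
congr (_ + _ + _ + _).
- rewrite coZ co_sig2 // co_angT (@co_xT0 _ i1 i3 _ _ _ _ (monE1 0 b c)) sub0r.
  case: c => [|c]; first by rewrite co_xT0 ?monE3 // oppr0 !mulr0.
  rewrite co_x3T1 2!co_refl monE1 monE3 expr1 exprS.
  transitivity (- ('i ^+ 2 * s * (dunkl_nat k1 1 * (-1 * ((-1) ^+ c * co (- s) v 1 b c))))).
    by move: (co _ _ _ _ _) => x; ring.
  by rewrite sqrCi; move: (co _ _ _ _ _) => x; ring.
- by rewrite coZ 2!co_refl monE1 monE3 mul1r.
- by rewrite coZ co_refl monE1 mul1r.
by rewrite coZ co_refl monE3.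
Qed.

Lemma co_BI3 s v b c : s ^+ 2 = 1 ->
  co s (BIop k1 k2 k3 i3 v) 0 b c =
    (if b is b'.+1 then 'i * ((-1) ^+ b * (dunkl_nat k1 1 * co (- s) v 1 b' c)) else 0)
    + 2^-1 * ((-1) ^+ b * co s v 0 b c)
    + k1 * ((-1) ^+ b * co s v 0 b c) + k2 * co s v 0 b c.
Proof.
move=> s2; rewrite [BIop _ _ _ _ _]/BIop (_ : (i3 == i1) = false) // (_ : (i3 == i2) = false) //.
rewrite 3!coD; congr (_ + _ + _ + _).
- rewrite coZ co_sig3 co_angT (@co_xT0 _ i1 i2 _ _ _ _ (monE1 0 b c)) subr0.
  case: b => [|b]; first by rewrite co_xT0 ?monE2 // mulr0.
  rewrite co_x2T1 2!co_refl monE1 monE2 expr1 exprS.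
  by move: (co _ _ _ _ _) => x; ring.
- by rewrite coZ 2!co_refl monE1 monE2 mul1r.
- by rewrite coZ co_refl monE2.
by rewrite coZ co_refl monE1 mul1r.
Qed.
End Operators.
End Coefficients.

(** * Restriction to x_1 = 0 *)

Section Sequences.
Variable C : numClosedFieldType.
Variables (k1 k2 k3 : C) (n : nat).
Implicit Types (u : nat -> C) (s : C).

Definition opY s u j : C :=
  (-1) ^+ j * (j%:R + 2^-1 + k1 + k3) * u j
  - (if j is j'.+1 then (-1) ^+ j * ('i * s) * dunkl_nat k2 (n.+1 - j) * u j' else 0).

Definition opZ s u j : C :=
  (-1) ^+ (n - j) * ((n - j)%:R + 2^-1 + k1 + k2) * u j
  + (-1) ^+ (n - j) * ('i * s) * dunkl_nat k3 j.+1 * u j.+1.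

(** The scalar by which the central element [{Y,Z} - X] acts on [M_n] for odd [n]. *)
Definition kappaM : C := - 2 * k1 * (k1 + k2 + k3 + n%:R + 1) + 2 * k2 * k3.

(** Defined through the relation, so that the matrix of [X] on a window follows from those of [Y]
    and [Z]; [opXE] gives the direct formula. *)
Definition opX s u j : C :=
  opY s (opZ s u) j + opZ s (opY s u) j - kappaM * u j.

Definition op (g : 'I_3) : C -> (nat -> C) -> nat -> C :=
  if g == i1 then opX else if g == i2 then opY else opZ.

Lemma opXE s u j : odd n -> s ^+ 2 = 1 -> (j <= n)%N ->
  opX s u j = 'i * s * (dunkl_nat k3 j.+1 * u j.+1
      - (if j is j'.+1 then dunkl_nat k2 (n.+1 - j) * u j' else 0))
    - 2^-1 * u j + k2 * (-1) ^+ j * u j + k3 * (-1) ^+ (n - j) * u j.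
Proof.
move=> odd_n s2 le_jn.
have s2' : 'i * s * ('i * s) = -1 :> C by rewrite mulrACA -expr2 sqrCi -expr2 s2 mulr1.
have [b eb] : exists b, n = (b + j)%N by exists (n - j)%N; rewrite subnK.
have odd_b : odd b = ~~ odd j by move: odd_n; rewrite eb oddD; case: (odd b); case: (odd j).
have -> : opX s u j = opY s (opZ s u) j + opZ s (opY s u) j - kappaM * u j by [].
move: s2'; rewrite /opY /opZ /kappaM; move: ('i * s) => w w2.
have -> : (n - j)%N = b by rewrite eb addnK.
have -> : (n.+1 - j)%N = b.+1 by rewrite eb -addSn addnK.
have -> : (n.+1 - j.+1)%N = b by rewrite eb subSS addnK.
have -> : (n%:R : C) = b%:R + j%:R by rewrite eb natrD.
have esg : ((-1) ^+ b : C) = - (-1) ^+ j.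
  rewrite -signr_odd odd_b -[in RHS]signr_odd.
  by case: (odd j); rewrite ?expr0 ?expr1 ?opprK.
case: j le_jn eb odd_b esg => [|j] le_jn eb odd_b esg.
  by rewrite /dunkl_nat odd_b esg expr0 expr1 /=; field: w2.
have -> : (n - j)%N = b.+1 by rewrite eb addnS -addSn addnK.
rewrite !exprS esg /dunkl_nat /= odd_b exprS -signr_odd /=.
by case: (odd j); rewrite /= ?expr0 ?expr1; field: w2.
Qed.

(** The bounds 1 and 0 force the zero sequence, so the zero submodule is also described by a
    range. *)
Definition adm lo hi u := (forall j, (j < lo)%N -> u j = 0) /\ (forall j, (hi < j)%N -> u j = 0).

(** The only way out of the range is from [hi] to [hi + 1], with coefficient
    [dunkl_nat k2 (n - hi)]. *)
Lemma opY_adm lo hi s u : (hi <= n)%N -> dunkl_nat k2 (n - hi) = 0 ->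
  adm lo hi u -> adm lo hi (opY s u).
Proof.
move=> le_hi dn0 [ulo uhi]; split=> j lt_j; rewrite /opY.
  rewrite ulo // mulr0; case: j lt_j => [|j] lt_j; first by rewrite subr0.
  by rewrite ulo ?mulr0 ?subr0 // ltnW.
rewrite uhi // mulr0; case: j lt_j => [|j] lt_j; first by rewrite subr0.
rewrite subSS; move: lt_j; rewrite ltnS leq_eqVlt => /predU1P[<-|/uhi->].
  by rewrite dn0 mulr0 mul0r subr0.
by rewrite mulr0 subr0.
Qed.

Lemma opZ_adm lo hi s u : dunkl_nat k3 lo = 0 -> adm lo hi u -> adm lo hi (opZ s u).
Proof.
move=> dn0 [ulo uhi]; split=> j lt_j; rewrite /opZ.
  rewrite ulo // mulr0 add0r; move: lt_j; rewrite leq_eqVlt => /predU1P[->|/ulo->].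
    by rewrite dn0 mulr0 mul0r.
  by rewrite mulr0.
by rewrite !uhi ?mulr0 ?addr0 // ltnW.
Qed.

(* Coordinates of a sequence along the window J 0, ..., J d, rescaled so that the
   off-diagonal entries of the lowering operator become constant. *)
Section Window.
Variables (d : nat) (J : nat -> nat) (e : C) (l : nat -> C).

Fixpoint scale r : C := if r is r'.+1 then scale r' * (e / l r) else 1.

Definition window u : 'cV[C]_d.+1 := \col_r (scale r * u (J r)).

Hypothesis e2 : e ^+ 2 = 1.
Hypothesis nz_l : forall r, (0 < r <= d)%N -> l r != 0.

Lemma scale_neq0 r : (r <= d)%N -> scale r != 0.
Proof.
elim: r => [|r IHr] le_rd; first exact: oner_neq0.
rewrite /= mulf_neq0 ?IHr ?(ltnW le_rd) // mulf_neq0 ?invr_eq0 ?nz_l //.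
by apply: contra_eq_neq e2 => ->; rewrite expr0n eq_sym oner_eq0.
Qed.

Lemma window_lower (a : C) u Lu :
  (forall r, (r <= d)%N -> Lu (J r) =
     e * theta d a r * u (J r) + (if r is r'.+1 then l r * u (J r') else 0)) ->
  window Lu = e *: (LX d a *m window u).
Proof.
move=> eL; apply/matrixP=> r q; rewrite !mxE.
have le_rd : (r <= d)%N by rewrite -ltnS.
transitivity (e * (theta d a r * (scale r * u (J r))
   + (if (r : nat) is r'.+1 then scale r' * u (J r') else 0))).
  rewrite eL //; case: (nat_of_ord r) le_rd => [|i] lt_id /=; first by ring.
  have nz : l i.+1 != 0 by apply: nz_l.
  by field.
congr (_ * _); rewrite (bigD1 r) //= !mxE eqxx; congr (_ + _).
case er: (nat_of_ord r) => [|i].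
  rewrite big1 // => x ne_xr; rewrite !mxE eq_sym.
  by rewrite (negPf (ne_xr : (x != r :> nat))) er mul0r.
have lt_id : (i < d.+1)%N by rewrite -er in le_rd *; have := ltn_ord r; lia.
have ne_ir : Ordinal lt_id != r by rewrite -val_eqE /= er; lia.
rewrite (bigD1 (Ordinal lt_id)) //= big1 ?addr0.
  by rewrite !mxE /= er eqxx (gtn_eqF (ltnSn i)) mul1r.
move=> x /andP[ne_xr ne_xi]; rewrite !mxE eq_sym (negPf (ne_xr : (x != r :> nat))).
by rewrite er eqSS eq_sym (negPf (ne_xi : (x != i :> nat))) mul0r.
Qed.

(** Once the lowering entries are rescaled, the raising entries become the products of opposite
    off-diagonal entries. *)
Lemma window_upper (b : C) phi (m : nat -> C) u Uu :
  (forall r, (r <= d)%N -> Uu (J r) =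
     e * theta d b r * u (J r) + (if (r < d)%N then m r * u (J r.+1) else 0)) ->
  (forall r, (r < d)%N -> l r.+1 * m r = phi r.+1) ->
  window Uu = e *: (LY d b phi *m window u).
Proof.
move=> eU elm; apply/matrixP=> r q; rewrite !mxE.
have le_rd : (r <= d)%N by rewrite -ltnS.
transitivity (e * (theta d b r * (scale r * u (J r))
   + (if (r < d)%N then phi r.+1 * (scale r.+1 * u (J r.+1)) else 0))).
  rewrite eU //; case: ifP => lt_rd; last by ring.
  rewrite -elm //= mulrDr [RHS]mulrDr; congr (_ + _); first by ring.
  have nz : l r.+1 != 0 by apply: nz_l.
  transitivity (e ^+ 2 * (scale r * (m r * u (J r.+1)))); first by rewrite e2 mul1r.
  by field.
congr (_ * _); rewrite (bigD1 r) //= !mxE eqxx; congr (_ + _).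
case: ifP => lt_rd; last first.
  rewrite big1 // => x ne_xr; rewrite !mxE.
  rewrite eq_sym (negPf (ne_xr : (x != r :> nat))) ifN ?mul0r //.
  by have := ltn_ord x; lia.
have ne_ir : Ordinal (lt_rd : (r.+1 < d.+1)%N) != r by rewrite -val_eqE /=; lia.
rewrite (bigD1 (Ordinal (lt_rd : (r.+1 < d.+1)%N))) //= big1 ?addr0.
  by rewrite !mxE /= eqxx (ltn_eqF (ltnSn r)).
move=> x /andP[ne_xr ne_xi]; rewrite !mxE eq_sym (negPf (ne_xr : (x != r :> nat))).
by rewrite eq_sym (negPf (ne_xi : (x != r.+1 :> nat))) mul0r.
Qed.

End Window.
End Sequences.

(** * Elements of M_n and their restrictions *)

Section Monogenic.
Variables (C : numClosedFieldType) (k1 k2 k3 : C) (n : nat).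
Local Notation V := ({mpoly C[3]} * {mpoly C[3]})%type.
Implicit Types (v w : V).
Hypothesis dunkl1_neq0 : forall a, (a < n)%N -> dunkl_nat k1 a.+1 != 0.
Local Notation M := (Mn k1 k2 k3 n).
Local Notation dn := dunkl_nat.

Local Opaque co dunkl refl sig vmap angT dirac BIop dunkl_nat.

Definition sg (e : bool) : C := (-1) ^+ e.

Lemma sg_sqr e : sg e ^+ 2 = 1. Proof. by rewrite /sg sqrr_sign. Qed.

Lemma sgN e : - sg e = sg (~~ e).
Proof. by case: e; rewrite /sg /= ?expr0 ?expr1 ?opprK. Qed.

(* An element of M is determined by its restriction to x_1 = 0. *)
Definition restr e v j : C := co (sg e) v 0 (n - j) j.

Lemma Mn_co0 v s a b c : M v -> (a + b + c)%N != n -> co s v a b c = 0.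
Proof.
case=> h1 [h2 _] ne; rewrite coE; have ne' : mdeg (mon a b c) != n by rewrite mdeg_mon.
by rewrite (dhomog_nemf_coeff h1 ne') (dhomog_nemf_coeff h2 ne') mulr0 addr0.
Qed.

Lemma Mn_dirac v e a b c : M v ->
  sg e * dn k1 a.+1 * co (sg e) v a.+1 b c
  + 'i * sg e * dn k2 b.+1 * co (sg (~~ e)) v a b.+1 c
  + dn k3 c.+1 * co (sg (~~ e)) v a b c.+1 = 0.
Proof.
case=> _ [_ d0]; rewrite -!sgN.
transitivity (co (sg e) (dirac k1 k2 k3 v) a b c); first by rewrite co_dirac ?sg_sqr.
by rewrite d0 -[0](scale0r (0 : V)) coZ mul0r.
Qed.

Lemma restr_gt e v j : M v -> (n < j)%N -> restr e v j = 0.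
Proof. by move=> Mv lt_nj; apply: Mn_co0 => //; lia. Qed.

Lemma restr_lin e x v w j : restr e (x *: v + w) j = x * restr e v j + restr e w j.
Proof. exact: co_lin. Qed.

Lemma sgMsg e x : sg e * (sg e * x) = x.
Proof. by rewrite mulrA -expr2 sg_sqr mul1r. Qed.

(** The coefficient of [x_1] in [co_BI2] is eliminated by [D v = 0] read at exponent 0 of [x_1], in
    the opposite eigenspace of [e_1]. *)
Lemma restr_BI2 e v j : M v -> (j <= n)%N ->
  restr e (BIop k1 k2 k3 i2 v) j = opY k1 k2 k3 n (sg e) (restr e v) j.
Proof.
move=> Mv le_jn; rewrite [LHS]co_BI2 ?sg_sqr // /opY.
transitivity ((-1) ^+ j * (dn k3 j + 2^-1 + k1) * co (sg e) v 0 (n - j) j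
    + k3 * co (sg e) v 0 (n - j) j
   - (if j is j'.+1 then (-1) ^+ j * ('i * sg e) * dn k2 (n.+1 - j)
        * co (sg e) v 0 (n - j') j' else 0)); last first.
  by rewrite -mulrDl dunkl_nat_sign.
case: j le_jn => [|j] lt_jn.
  rewrite dunkl_nat0.
  by move: (co _ _ _ _ _) => x; ring.
have := @Mn_dirac v (~~ e) 0 (n - j.+1) j Mv; rewrite negbK -sgN.
have -> : (n - j = (n - j.+1).+1)%N by lia.
have -> : (n.+1 - j.+1 = (n - j.+1).+1)%N by lia.
move: (co (- sg e) _ _ _ _) (co _ _ 0 _ j) (co _ _ 0 _ j.+1) => x y z h.
move: (dn k1 1) (dn k2 _) (dn k3 _) h => p q r h.
by apply: (@eq_by_multiple _ (- (-1) ^+ j.+1) _ _ _ _ h); ring.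
Qed.

Lemma restr_BI3 e v j : M v -> (j <= n)%N ->
  restr e (BIop k1 k2 k3 i3 v) j = opZ k1 k2 k3 n (sg e) (restr e v) j.
Proof.
move=> Mv le_jn; rewrite [LHS]co_BI3 ?sg_sqr // /opZ.
transitivity ((-1) ^+ (n - j) * (dn k2 (n - j) + 2^-1 + k1) * co (sg e) v 0 (n - j) j
    + k2 * co (sg e) v 0 (n - j) j
    + (-1) ^+ (n - j) * ('i * sg e) * dn k3 j.+1 * restr e v j.+1); last first.
  by rewrite -mulrDl dunkl_nat_sign.
have s2 : sg e * sg e = 1 by rewrite -expr2 sg_sqr.
have i2 : 'i * 'i = -1 :> C by rewrite -expr2 sqrCi.
case eb: (n - j)%N => [|b].
  rewrite dunkl_nat0 restr_gt //; last by lia.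
  by move: (co _ _ _ _ _) => x; ring.
have := @Mn_dirac v (~~ e) 0 b j Mv; rewrite negbK -sgN.
rewrite /restr (_ : (n - j.+1)%N = b); last by lia.
move: (co (- sg e) _ _ _ _) (co _ _ 0 _ j) (co _ _ 0 _ j.+1) => x y z.
move: (dn k1 1) (dn k2 _) (dn k3 _) (sg e) s2 => p q r s s2 h.
by apply: (@eq_by_multiple _ (- (-1) ^+ b.+1 * 'i * s) _ _ _ _ h); ring: s2 i2.
Qed.

Lemma restr_BI1 e v j : odd n -> M v -> (j <= n)%N ->
  restr e (BIop k1 k2 k3 i1 v) j = opX k1 k2 k3 n (sg e) (restr e v) j.
Proof.
move=> odd_n Mv le_jn; rewrite opXE ?sg_sqr //.
have en : ((-1) ^+ (n - j) : C) = - (-1) ^+ j.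
  by rewrite -signr_odd oddB // odd_n -[in RHS]signr_odd; case: (odd j);
    rewrite ?expr0 ?expr1 ?opprK.
have ej := sign_sqr C j.
rewrite /restr co_BI1 ?sg_sqr // en -/(restr e v j) -/(restr e v j.+1).
set u := restr e v.
have -> : (if j is c.+1 then dn k2 (n - j).+1 * ((-1) ^+ (n - j).+1
      * ((-1) ^+ c * co (sg e) v 0 (n - j).+1 c)) else 0)
    = - (if j is c.+1 then dn k2 (n.+1 - j) * u c else 0).
  case: j le_jn en ej => [|c] lt_cn en ej; first by rewrite oppr0.
  rewrite /u /restr (_ : (n - c)%N = (n - c.+1).+1); last by lia.
  rewrite (_ : (n.+1 - c.+1)%N = (n - c.+1).+1); last by lia.
  rewrite exprS en; move: (co _ _ _ _ _) (dn _ _) => y p.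
  by rewrite exprS in ej *; move: ((-1) ^+ c) ej => t ej; ring: ej.
have -> : (if (n - j)%N is b.+1 then dn k3 j.+1 * ((-1) ^+ b
      * ((-1) ^+ j.+1 * co (sg e) v 0 b j.+1)) else 0) = - (dn k3 j.+1 * u j.+1).
  case eb: (n - j)%N => [|b].
    by rewrite /u restr_gt //; [rewrite mulr0 oppr0 | lia].
  rewrite /u /restr (_ : (n - j.+1)%N = b); last by lia.
  rewrite eb exprS in en; move: (co _ _ _ _ _) (dn _ _) => y p.
  have {en} -> : (-1) ^+ b = (-1) ^+ j :> C by apply: oppr_inj; rewrite -en mulN1r.
  by rewrite exprS; move: ((-1) ^+ j) ej => t ej; ring: ej.
move: (if j is c.+1 then dn k2 (n.+1 - j) * u c else 0) => z.
move: (u j) (u j.+1) (dn _ _) ((-1) ^+ j) ej => x y p t ej.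
by ring: ej.
Qed.

Lemma restr_op g e v j : odd n -> M v -> (j <= n)%N ->
  restr e (BIop k1 k2 k3 g v) j = op k1 k2 k3 n g (sg e) (restr e v) j.
Proof.
move=> odd_n Mv le_jn; case: (ord3_cases g) => ->.
- exact: restr_BI1.
- exact: restr_BI2.
- exact: restr_BI3.
Qed.

Lemma mcoeff_co v (m : 'X_{1..3}) : (forall e, co (sg e) v (m i1) (m i2) (m i3) = 0) ->
  v.1@_m = 0 /\ v.2@_m = 0.
Proof.
move=> v0; have e1 := v0 false; have e2 := v0 true.
move: e1 e2; rewrite !coE -mon_eta /sg expr0 expr1 mul1r mulN1r.
move: (v.1@_m) (v.2@_m) => y z e1 e2.
have nz2 : 2 != 0 :> C by rewrite pnatr_eq0.
split; apply: (mulfI nz2); rewrite mulr0.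
  by transitivity (y + z + (y - z)); [ring | rewrite e1 e2 addr0].
by transitivity (y + z - (y - z)); [ring | rewrite e1 e2 subr0].
Qed.

Lemma co_eq0P v : (forall e a b c, co (sg e) v a b c = 0) -> v = 0.
Proof.
move=> v0; have v12 m := @mcoeff_co v m (fun e => v0 e _ _ _).
have -> : (0 : V) = (0, 0) by [].
case: v v0 v12 => v1 v2 _ v12.
by congr (_, _); apply/mpolyP=> m; rewrite mcoeff0; have [] := v12 m.
Qed.

(* Q is a set of monomials of R[x_2, x_3] avoided by the restriction; the
   relation D v = 0 propagates this to all powers of x_1. *)
Lemma co_propagate v (Q : nat -> nat -> bool) : M v ->
  (forall b c, Q b c -> (dn k2 b.+1 = 0 \/ Q b.+1 c) /\ (dn k3 c.+1 = 0 \/ Q b c.+1)) ->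
  (forall e b c, Q b c -> co (sg e) v 0 b c = 0) ->
  forall e a b c, Q b c -> co (sg e) v a b c = 0.
Proof.
move=> Mv Qstep Q0 e a; elim: a e => [|a IHa] e b c Qbc; first exact: Q0.
have [/eqP en|ne] := boolP ((a.+1 + b + c)%N == n); last exact: Mn_co0.
have [d2 d3] := Qstep b c Qbc; have := Mn_dirac e a b c Mv.
have e2 : dn k2 b.+1 * co (sg (~~ e)) v a b.+1 c = 0.
  by case: d2 => [->|/IHa->]; rewrite ?mul0r ?mulr0.
have e3 : dn k3 c.+1 * co (sg (~~ e)) v a b c.+1 = 0.
  by case: d3 => [->|/IHa->]; rewrite ?mul0r ?mulr0.
rewrite -[X in _ + X + _]mulrA e2 e3 mulr0 !addr0 -mulrA => h.
have := sgMsg e (dn k1 a.+1 * co (sg e) v a.+1 b c); rewrite h mulr0.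
move/esym/eqP; rewrite mulf_eq0 (negPf (dunkl1_neq0 _)); last by lia.
by move/eqP.
Qed.

Lemma restr_inj v : M v -> (forall e j, restr e v j = 0) -> v = 0.
Proof.
move=> Mv r0; apply: co_eq0P => e a b c.
apply: (co_propagate (Q := fun _ _ => true)) => // [|e' b' c' _]; first by split; right.
have [eb|ne] := boolP ((b' + c')%N == n); last by apply: Mn_co0.
by rewrite -(r0 e' c') /restr -(eqP eb) addnK.
Qed.

Section Extension.
Variable u : bool -> nat -> C.
Hypothesis u_gt : forall e j, (n < j)%N -> u e j = 0.

(* Cauchy-Kovalevskaya extension: D v = 0 solved recursively in powers of x_1. *)
Fixpoint ext a (e : bool) b c : C :=
  if a is a'.+1 then
    - sg e / dn k1 a * ('i * sg e * dn k2 b.+1 * ext a' (~~ e) b.+1 c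
                        + dn k3 c.+1 * ext a' (~~ e) b c.+1)
  else if (b + c)%N == n then u e c else 0.

Lemma ext_eq0 a e b c : (a + b + c)%N != n -> ext a e b c = 0.
Proof.
elim: a e b c => [|a IHa] e b c ne /=; first by rewrite (negPf ne).
by rewrite !IHa ?mulr0 ?addr0 ?mulr0 //; lia.
Qed.

(** The values 1 and -1 of [x] give the two components of the vector whose [e_1]-coordinates are
    [ext]. *)
Let comp (x : C) : {mpoly C[3]} := \sum_(m : 'X_{1..3 < n.+1})
  ((ext (m i1) false (m i2) (m i3) + x * ext (m i1) true (m i2) (m i3)) / 2) *: 'X_[m].

Let mcoeff_comp x a b c :
  (comp x)@_(mon a b c) = (ext a false b c + x * ext a true b c) / 2.
Proof.
have [lt_n|ge_n] := ltnP (mdeg (mon a b c)) n.+1.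
  rewrite /comp (mcoeff_mpoly (fun m => (ext (m i1) false (m i2) (m i3)
    + x * ext (m i1) true (m i2) (m i3)) / 2)) //.
  by rewrite monE1 monE2 monE3.
rewrite mdeg_mon in ge_n; rewrite !ext_eq0; try lia.
rewrite mulr0 addr0 mul0r /comp raddf_sum big1 //= => m _.
rewrite mcoeffZ mcoeffX; case: eqP => [em|_]; last by rewrite mulr0.
by have := bmdeg m; rewrite em mdeg_mon; lia.
Qed.

Lemma ext_exists : exists2 v, M v & forall e j, restr e v j = u e j.
Proof.
pose v : V := (comp 1, comp (-1)).
have cov e a b c : co (sg e) v a b c = ext a e b c.
  rewrite coE /v /= !mcoeff_comp /sg.
  by case: e => /=; rewrite ?expr0 ?expr1; field.
have comp_homog x : comp x \is n.-homog.
  apply/dhomogP => m; rewrite mcoeff_msupp (mon_eta m) mcoeff_comp => nz.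
  rewrite -[LHS]/(mdeg (mon (m i1) (m i2) (m i3))) mdeg_mon.
  apply/eqP; apply: contraNT nz => ne.
  by rewrite !ext_eq0 // mulr0 addr0 mul0r.
exists v; last first.
  move=> e j; rewrite /restr cov /=; have [le_jn|lt_nj] := leqP j n.
    by rewrite subnK // eqxx.
  by rewrite u_gt // if_same.
split; first exact: comp_homog.
split; first exact: comp_homog.
apply: co_eq0P => e a b c; rewrite co_dirac ?sg_sqr // sgN !cov /=.
have [lt_an|le_na] := ltnP a n.
  have nz := dunkl1_neq0 lt_an; have s2 : sg e * sg e = 1 by rewrite -expr2 sg_sqr.
  by field: s2.
by rewrite !(@ext_eq0 a); [rewrite !mulr0 !addr0 !mulr0 | lia | lia].
Qed.
End Extension.

Definition restr_adm lo hi v := M v /\ forall e, adm lo hi (restr e v).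

Lemma Mn_adm v : M v <-> restr_adm 0 n v.
Proof. by split=> [Mv|[]//]; split=> // e; split=> // j; apply: restr_gt. Qed.

Lemma co_msupp v s a b c : (mon a b c) \notin msupp v.1 ++ msupp v.2 -> co s v a b c = 0.
Proof.
rewrite mem_cat negb_or coE => /andP[/memN_msupp_eq0-> /memN_msupp_eq0->].
by rewrite mulr0 addr0.
Qed.

Lemma Mnx2_adm t v : (0 < t <= n)%N -> dn k2 t = 0 ->
  Mnx k1 k2 k3 n i2 t v <-> restr_adm 0 (n - t) v.
Proof.
move=> t_in dn0; split=> [[Mv vt]|[Mv va]]; split=> //.
  move=> e; split=> // j lt_j; have [lt_nj|le_jn] := ltnP n j; first exact: restr_gt.
  by apply: co_msupp; apply/negP => /vt; rewrite monE2; lia.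
move=> m; rewrite mem_cat !mcoeff_msupp; apply: contraTT; rewrite -ltnNge => lt_mt.
suff v0 e a b c : (b < t)%N -> co (sg e) v a b c = 0.
  by have [-> ->] := @mcoeff_co v m (fun e => v0 e _ _ _ lt_mt); rewrite eqxx.
(* The region [b < t] is left only at [b + 1 = t], exactly where [T_2] kills [x_2^t]. *)
apply: (co_propagate (Q := fun b _ => (b < t)%N)) => // [b' c' lt_b|e' b' c' lt_b].
  split; last by right.
  by move: lt_b; rewrite leq_eqVlt => /predU1P[->|]; [left | right].
have [/eqP eb|ne] := boolP ((b' + c')%N == n); last by apply: Mn_co0.
have [_ /(_ c')] := va e'; rewrite /restr (_ : (n - c')%N = b'); last by lia.
by apply; lia.
Qed.

Lemma Mnx3_adm t v : dn k3 t = 0 ->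
  Mnx k1 k2 k3 n i3 t v <-> restr_adm t n v.
Proof.
move=> dn0; split=> [[Mv vt]|[Mv va]]; split=> //.
  move=> e; split=> j lt_j; last exact: restr_gt.
  by apply: co_msupp; apply/negP => /vt; rewrite monE3; lia.
move=> m; rewrite mem_cat !mcoeff_msupp; apply: contraTT; rewrite -ltnNge => lt_mt.
suff v0 e a b c : (c < t)%N -> co (sg e) v a b c = 0.
  by have [-> ->] := @mcoeff_co v m (fun e => v0 e _ _ _ lt_mt); rewrite eqxx.
apply: (co_propagate (Q := fun _ c => (c < t)%N)) => // [b' c' lt_c|e' b' c' lt_c].
  split; first by right.
  by move: lt_c; rewrite leq_eqVlt => /predU1P[->|]; [left | right].
have [/eqP eb|ne] := boolP ((b' + c')%N == n); last by apply: Mn_co0.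
have [/(_ c') + _] := va e'; rewrite /restr (_ : (n - c')%N = b'); last by lia.
by apply; lia.
Qed.

Lemma restr_adm_meet v lo hi :
  restr_adm 0 hi v /\ restr_adm lo n v <-> restr_adm lo hi v.
Proof.
split=> [[[Mv a] [_ b]]|[Mv a]].
  by split=> // e; have [_ h] := a e; have [h' _] := b e.
split; split=> // e; have [h h'] := a e; split=> // j; exact: restr_gt.
Qed.

Lemma restr_adm_empty v : v = 0 <-> restr_adm 1 0 v.
Proof.
split=> [->|[Mv a]].
  have r0 e j : restr e 0 j = 0 by rewrite -[0 in LHS](scale0r (0 : V)) /restr coZ mul0r.
  split=> [|e]; last by split=> j _; apply: r0.
  split; first by rewrite rpred0.
  split; first by rewrite rpred0.
  apply: co_eq0P => e a b c; rewrite co_dirac ?sg_sqr //.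
  have z s x y t : co s (0 : V) x y t = 0 by rewrite -[0 in LHS](scale0r (0 : V)) coZ mul0r.
  by rewrite !z !mulr0 !addr0.
apply: restr_inj => // e [|j]; have [h h'] := a e; first exact: h.
exact: h'.
Qed.

Section Quotient.
Variables (lo hi lo' hi' d : nat) (J : nat -> nat) (x : C) (l : bool -> nat -> C).
Variable W : 'I_3 -> 'M[C]_d.+1.
Hypotheses (odd_n : odd n) (le_hi : (hi <= n)%N) (x2 : x ^+ 2 = 1).
Hypothesis nz_l : forall e r, (0 < r <= d)%N -> l e r != 0.
Hypothesis J_in : forall r, (r <= d)%N -> (lo <= J r <= hi)%N.
Hypothesis J_inj : forall r r', (r <= d)%N -> (r' <= d)%N -> J r = J r' -> r = r'.
Hypothesis J_out : forall r, (r <= d)%N -> ~~ (lo' <= J r <= hi')%N.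
Hypothesis J_cover : forall j, (lo <= j <= hi)%N -> ~~ (lo' <= j <= hi')%N ->
  exists2 r, (r <= d)%N & J r = j.
Hypothesis W_op : forall g e u, adm lo hi u ->
  window d J x (l e) (op k1 k2 k3 n g (sg e) u) = W g *m window d J x (l e) u.

(** The map takes window coordinates in both eigenspaces of [e_1]; surjectivity is the extension
    theorem. The scaling [l] depends on the eigenspace because the off-diagonal entries contain it
    as a factor, but the rescaled matrices agree, which gives two copies of the same [W]. *)
Lemma quot_window :
  quot_iso (BIop k1 k2 k3) (restr_adm lo hi) (restr_adm lo' hi') (dsum W).
Proof.
pose Ph e v := window d J x (l e) (restr e v).
have nz_scale e r : (r <= d)%N -> scale x (l e) r != 0.
  by apply: scale_neq0 => //; apply: nz_l.
exists (fun v => col_mx (Ph false v) (Ph true v)); split.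
- have Ph_lin e c a b : Ph e (c *: a + b) = c *: Ph e a + Ph e b.
    by apply/matrixP=> r q; rewrite !mxE restr_lin; ring.
  by move=> c a b _ _; rewrite !Ph_lin scale_col_mx add_col_mx.
- move=> w; pose half (e : bool) := if e then dsubmx w else usubmx w.
  pose u e j := if [pick r : 'I_d.+1 | J r == j] is Some r
    then half e r 0 / scale x (l e) r else 0.
  have u_out e j : ~~ (lo <= j <= hi)%N -> u e j = 0.
    rewrite /u; case: pickP => // r /eqP <-; rewrite J_in //.
    by rewrite -ltnS.
  have [|v Mv ev] := @ext_exists u.
    by move=> e j lt_j; apply: u_out; lia.
  exists v.
    by split=> // e; split=> j lt_j; rewrite ev u_out //; lia.
  have ePh e : Ph e v = half e.
    apply/matrixP=> r q; rewrite mxE ev ord1 /u; case: pickP => [r' /eqP eJ|/(_ r)].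
      have -> : r' = r by apply: val_inj; apply: J_inj eJ; rewrite -ltnS.
      have le_rd : (r <= d)%N by rewrite -ltnS.
      by rewrite mulrC divfK ?nz_scale.
    by rewrite eqxx.
  by rewrite !ePh /half vsubmxK.
- move=> v [Mv a]; split.
    move=> ph0; split=> // e.
    have Ph0 : Ph e v = 0.
      by move/eqP: ph0; rewrite col_mx_eq0 => /andP[/eqP h0 /eqP h1]; case: (e).
    have out j : ~~ (lo' <= j <= hi')%N -> restr e v j = 0.
      move=> j_out; have [j_in|] := boolP (lo <= j <= hi)%N; last first.
        have [h h'] := a e; rewrite negb_and -!ltnNge => /orP[/h//|/h'//].
      have [r le_rd <-] := J_cover j_in j_out.
      have /matrixP/(_ (Ordinal (le_rd : (r < d.+1)%N)) 0) := Ph0.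
      by rewrite !mxE /= => /eqP; rewrite mulf_eq0 (negPf (nz_scale _ _ _)) // => /eqP.
    by split=> j lt_j; apply: out; lia.
  case=> _ b; have Ph0 e : Ph e v = 0.
    apply/matrixP=> r q; rewrite !mxE; have [h h'] := b e.
    have : ~~ (lo' <= J r <= hi')%N by apply: J_out; rewrite -ltnS.
    by rewrite negb_and -!ltnNge => /orP[/h->|/h'->]; rewrite mulr0.
  by rewrite !Ph0 col_mx0.
move=> g v [Mv a]; rewrite /dsum mul_block_col !mul0mx addr0 add0r.
have PhW e : Ph e (BIop k1 k2 k3 g v) = W g *m Ph e v.
  rewrite -W_op //; apply/matrixP=> r q; rewrite !mxE restr_op //.
  by have := J_in (ltn_ord r : (r <= d)%N); lia.
by rewrite !PhW.
Qed.
End Quotient.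

(** The two vanishing coefficients keep [Y u] and [Z u] inside the range, so the matrix formulas can
    be composed. *)
Lemma window_opX lo hi d J x l (WX WY WZ : 'M[C]_d.+1) s :
  (hi <= n)%N -> dn k2 (n - hi) = 0 -> dn k3 lo = 0 ->
  (forall u, adm lo hi u ->
     window d J x l (opY k1 k2 k3 n s u) = WY *m window d J x l u) ->
  (forall u, adm lo hi u ->
     window d J x l (opZ k1 k2 k3 n s u) = WZ *m window d J x l u) ->
  WX = anticomm WY WZ - (kappaM k1 k2 k3 n)%:M ->
  forall u, adm lo hi u ->
    window d J x l (opX k1 k2 k3 n s u) = WX *m window d J x l u.
Proof.
move=> le_hi dn2 dn3 hY hZ -> u a.
rewrite mulmxBl mulmxDl mul_scalar_mx -!mulmxA -hY // -hZ //.
rewrite -(hY (opZ _ _ _ _ _ _)); last exact: opZ_adm.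
rewrite -(hZ (opY _ _ _ _ _ _)); last exact: opY_adm.
by apply/matrixP=> r q; rewrite !mxE /opX; ring.
Qed.

End Monogenic.

(** * Windows in decreasing and increasing order *)

Section Quotients.
Variables (C : numClosedFieldType) (k1 k2 k3 : C) (n : nat).
Hypothesis odd_n : odd n.
Hypothesis dunkl1_neq0 : forall a, (a < n)%N -> dunkl_nat k1 a.+1 != 0.
Local Notation dn := dunkl_nat.
Variables (lo hi lo' hi' d : nat) (x a b : C) (phi : nat -> C).
Variable W : 'I_3 -> 'M[C]_d.+1.
Hypotheses (le_hi : (hi <= n)%N) (x2 : x ^+ 2 = 1).
Hypotheses (dn2_hi : dn k2 (n - hi) = 0) (dn3_lo : dn k3 lo = 0).
Hypothesis WX : W i1 = anticomm (LX d a) (LY d b phi) - (kappaM k1 k2 k3 n)%:M.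

Let iu2 s : s ^+ 2 = 1 -> 'i * s * ('i * s) = -1 :> C.
Proof. by move=> s2; rewrite mulrACA -expr2 sqrCi -expr2 s2 mulr1. Qed.

Let iu_neq0 s : s ^+ 2 = 1 -> 'i * s != 0 :> C.
Proof.
move=> s2; apply/eqP=> e; have := iu2 s2; rewrite e mul0r => /eqP.
by rewrite eq_sym oppr_eq0 oner_eq0.
Qed.

Let sign_neq0 k : (-1) ^+ k != 0 :> C.
Proof. by rewrite expf_neq0 // oppr_eq0 oner_eq0. Qed.

Let eq_opp k : (k <= n)%N -> (-1) ^+ (n - k) = - (-1) ^+ k :> C.
Proof.
move=> le_kn; rewrite -signr_odd oddB // odd_n -[in RHS]signr_odd.
by case: (odd k); rewrite ?expr0 ?expr1 ?opprK.
Qed.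

Let anticomm_scale (A B : 'M[C]_d.+1) : anticomm (x *: A) (x *: B) = anticomm A B.
Proof.
by rewrite /anticomm -!scalemxAl -!scalemxAr !scalerA -expr2 x2 !scale1r.
Qed.

(* Windows running down from the largest exponent of x_3: Z lowers, Y raises. *)
Lemma quot_decreasing :
  W i3 = x *: LX d a -> W i2 = x *: LY d b phi -> (lo + d <= hi)%N ->
  (hi - d = lo)%N \/ dn k2 (n.+1 - (hi - d)) = 0 ->
  (forall j, (lo <= j <= hi)%N -> ~~ (lo' <= j <= hi')%N = (hi - d <= j)%N) ->
  (forall r, (r <= d)%N ->
    (-1) ^+ (n - (hi - r)) * ((n - (hi - r))%:R + 2^-1 + k1 + k2) = x * theta d a r) ->
  (forall r, (r <= d)%N ->
    (-1) ^+ (hi - r) * ((hi - r)%:R + 2^-1 + k1 + k3) = x * theta d b r) ->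
  (forall r, (0 < r <= d)%N -> dn k3 (hi - r).+1 != 0) ->
  (forall r, (r < d)%N -> dn k3 (hi - r) * dn k2 (n.+1 - (hi - r)) = phi r.+1) ->
  quot_iso (BIop k1 k2 k3) (restr_adm k1 k2 k3 n lo hi) (restr_adm k1 k2 k3 n lo' hi')
    (dsum W).
Proof.
move=> WZ WY le_d bot out diagZ diagY nz3 prod.
pose J r := (hi - r)%N.
pose l e r : C := (-1) ^+ (n - J r) * ('i * sg C e) * dn k3 (J r).+1.
have nz_l e r : (0 < r <= d)%N -> l e r != 0.
  move=> lt_r; apply: mulf_neq0 (nz3 _ lt_r).
  by apply: mulf_neq0 (sign_neq0 _) _; apply/iu_neq0/sg_sqr.
have hZ e u : adm lo hi u ->
    window d J x (l e) (opZ k1 k2 k3 n (sg C e) u) = W i3 *m window d J x (l e) u.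
  move=> [_ uhi]; rewrite WZ -scalemxAl; apply: (window_lower (nz_l e)) => r le_rd.
  rewrite /opZ /J diagZ //; congr (_ + _); case: r le_rd => [|r] le_rd.
    by rewrite subn0 uhi ?mulr0.
  by rewrite /l /J (_ : (hi - r.+1).+1 = (hi - r)%N); last lia.
have hY e u : adm lo hi u ->
    window d J x (l e) (opY k1 k2 k3 n (sg C e) u) = W i2 *m window d J x (l e) u.
  move=> [ulo _]; rewrite WY -scalemxAl.
  apply: (window_upper x2 (nz_l e)
    (m := fun r => - ((-1) ^+ J r * ('i * sg C e) * dn k2 (n.+1 - J r)))).
    move=> r le_rd; rewrite /opY /J diagY //; congr (_ + _).
    case: ifP => [lt_rd|ge_rd].
      rewrite (_ : (hi - r)%N = (hi - r.+1).+1); last lia.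
      by rewrite mulNr.
    (* In the last row [Y] reaches below the window: either that entry of [u] is outside the range,
       or its coefficient vanishes at the threshold of [x_2]. *)
    have -> : r = d by lia.
    case ej: (hi - d)%N => [|j]; first by rewrite oppr0.
    case: bot => [elo|dn2]; first by rewrite ulo ?mulr0 ?oppr0 //; lia.
    by rewrite -ej dn2 mulr0 mul0r oppr0.
  move=> r lt_rd; rewrite -prod // /l (_ : (J r.+1).+1 = J r); last by rewrite /J; lia.
  rewrite (_ : (n - J r.+1)%N = (n - J r).+1); last by rewrite /J; lia.
  rewrite exprS eq_opp; last by rewrite /J; lia.
  have e1 := sign_sqr C (J r); have e2 := iu2 (sg_sqr C e).
  rewrite -/(J r); move: ((-1) ^+ J r) ('i * sg C e) e1 e2 => t w e1 e2.
  by move: (dn k3 _) (dn k2 _) => p q; ring: e1 e2.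
apply: (quot_window dunkl1_neq0 (J := J) (x := x) (l := l)) => //.
- by move=> r le_rd; rewrite /J; lia.
- by move=> r r' le_rd le_rd'; rewrite /J; lia.
- by move=> r le_rd; rewrite out /J; lia.
- by move=> j j_in; rewrite out // => le_j; exists (hi - j)%N; rewrite /J; lia.
move=> g e u ad; case: (ord3_cases g) => ->; [|exact: hY|exact: hZ].
apply: (window_opX (WY := W i2) (WZ := W i3) le_hi dn2_hi dn3_lo) => //.
  by move=> u'; apply: hY.
  by move=> u'; apply: hZ.
by rewrite WX WY WZ anticomm_scale; congr (_ - _); apply: addrC.
Qed.

(* Windows running up from the exponent 0 of x_3: Y lowers, Z raises. *)
Lemma quot_increasing :
  W i2 = x *: LX d a -> W i3 = x *: LY d b phi -> lo = 0%N -> (d <= hi)%N ->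
  dn k3 d.+1 = 0 ->
  (forall j, (lo <= j <= hi)%N -> ~~ (lo' <= j <= hi')%N = (j <= d)%N) ->
  (forall r, (r <= d)%N ->
    (-1) ^+ r * (r%:R + 2^-1 + k1 + k3) = x * theta d a r) ->
  (forall r, (r <= d)%N ->
    (-1) ^+ (n - r) * ((n - r)%:R + 2^-1 + k1 + k2) = x * theta d b r) ->
  (forall r, (0 < r <= d)%N -> dn k2 (n.+1 - r) != 0) ->
  (forall r, (r < d)%N -> dn k2 (n - r) * dn k3 r.+1 = phi r.+1) ->
  quot_iso (BIop k1 k2 k3) (restr_adm k1 k2 k3 n lo hi) (restr_adm k1 k2 k3 n lo' hi')
    (dsum W).
Proof.
move=> WY WZ lo0 le_d top out diagY diagZ nz2 prod.
pose l e r : C := - ((-1) ^+ r * ('i * sg C e) * dn k2 (n.+1 - r)).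
have nz_l e r : (0 < r <= d)%N -> l e r != 0.
  move=> lt_r; rewrite oppr_eq0; apply: mulf_neq0 (nz2 _ lt_r).
  by apply: mulf_neq0 (sign_neq0 _) _; apply/iu_neq0/sg_sqr.
have hY e u :
    window d id x (l e) (opY k1 k2 k3 n (sg C e) u) = W i2 *m window d id x (l e) u.
  rewrite WY -scalemxAl; apply: (window_lower (nz_l e)) => r le_rd.
  rewrite /opY diagY //; congr (_ + _); case: r le_rd => [|r] le_rd.
    by rewrite oppr0.
  by rewrite /l mulNr.
have hZ e u :
    window d id x (l e) (opZ k1 k2 k3 n (sg C e) u) = W i3 *m window d id x (l e) u.
  rewrite WZ -scalemxAl.
  apply: (window_upper x2 (nz_l e)
    (m := fun r => (-1) ^+ (n - r) * ('i * sg C e) * dn k3 r.+1)).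
    move=> r le_rd; rewrite /opZ diagZ //; congr (_ + _).
    case: ifP => [//|ge_rd]; have -> : r = d by lia.
    by rewrite top mulr0 mul0r.
  move=> r lt_rd; rewrite -prod // /l subSS exprS eq_opp; last by lia.
  have e1 := sign_sqr C r; have e2 := iu2 (sg_sqr C e).
  move: ((-1) ^+ r) ('i * sg C e) e1 e2 => t w e1 e2.
  by move: (dn k3 _) (dn k2 _) => p q; ring: e1 e2.
apply: (quot_window dunkl1_neq0 (J := id) (x := x) (l := l)) => //.
- by move=> r le_rd /=; lia.
- by move=> r le_rd; rewrite out; lia.
- by move=> j j_in; rewrite out // => le_j; exists j.
move=> g e u ad; case: (ord3_cases g) => ->; [|exact: hY|exact: hZ].
apply: (window_opX (WY := W i2) (WZ := W i3) le_hi dn2_hi dn3_lo) => //.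
by rewrite WX WY WZ anticomm_scale.
Qed.
End Quotients.

(** * Matching the windows with E_d and O_d *)

Section ParameterChecks.
Variables (C : numClosedFieldType) (k1 k2 k3 : C) (p q m n : nat).
Hypotheses (even_p : ~~ odd p) (even_q : ~~ odd q) (odd_n : odd n).
Hypothesis n_eq : n = (p + q + 2 + m)%N.
Hypotheses (k2_eq : k2 = - p.+1%:R / 2) (k3_eq : k3 = - q.+1%:R / 2).
Hypothesis dunkl1_neq0 : forall a, (a < n)%N -> dunkl_nat k1 a.+1 != 0.
Let K := k1 + k2 + k3.
Let N : C := (n%:R + 1) / 2.
Local Notation dn := dunkl_nat.

(** At an odd exponent [t + 1 + i] the term [2 k] cancels [t + 1]. Past the threshold the
    coefficient is thus a natural number, and it vanishes at [i = 0] only. *)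
Lemma dunkl_nat_shift t i : ~~ odd t ->
  dn (- t.+1%:R / 2 : C) (t.+1 + i) = if odd i then (t.+1 + i)%:R else i%:R.
Proof.
move=> even_t; rewrite /dn oddD /= even_t /=.
by case: (odd i); rewrite /= ?addr0 // natrD; field.
Qed.

Lemma dunkl_nat_shift_neq0 t i : ~~ odd t -> (0 < i)%N ->
  dn (- t.+1%:R / 2 : C) (t.+1 + i) != 0.
Proof.
move=> even_t i_gt0; rewrite dunkl_nat_shift //.
by case: ifP => _; rewrite pnatr_eq0; lia.
Qed.

Lemma dunkl_nat_top t : ~~ odd t -> dn (- t.+1%:R / 2 : C) t.+1 = 0.
Proof. by move=> even_t; have := dunkl_nat_shift 0 even_t; rewrite addn0. Qed.

Let sgD t i : ~~ odd t -> (-1) ^+ (t.+1 + i) = - (-1) ^+ i :> C.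
Proof. by move=> even_t; rewrite exprD -signr_odd /= even_t expr1 mulN1r. Qed.

(** The window is the whole range from [t_3] to [n - t_2]. The exponent of [x_2] starts at the odd
    number [t_2], which makes the first sign on the diagonal of [Z] negative and accounts for the
    sign [-1] in the twist. *)
Lemma quot_W1 :
  quot_iso (BIop k1 k2 k3) (restr_adm k1 k2 k3 n q.+1 (n - p.+1))
    (restr_adm k1 k2 k3 n 1 0)
    (dsum (twist_aut (sgn_mm C) perm13 (Emod m (k1 + k3 + N) (- k1 - k2 - N) N))).
Proof.
have odd_m : odd m.
  by move: odd_n; rewrite n_eq !oddD (negPf even_p) (negPf even_q).
have odd_rj r j : m = (r + j)%N -> odd j = ~~ odd r.
  by move=> em; move: odd_m; rewrite em oddD; case: (odd r); case: (odd j).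
apply: (quot_decreasing odd_n dunkl1_neq0 (d := m) (x := -1) (a := k1 + k3 + N)
  (b := - k1 - k2 - N) (phi := phiE m (k1 + k3 + N) (- k1 - k2 - N) N)).
- by lia.
- by rewrite sqrrN expr1n.
- by rewrite k2_eq (_ : (n - _)%N = p.+1) ?dunkl_nat_top //; lia.
- by rewrite k3_eq dunkl_nat_top.
- rewrite /twist_aut /= scale1r /Emod /=; congr (_ - _%:M).
  by rewrite /kappaM /N k2_eq k3_eq n_eq; field.
- by [].
- by [].
- by lia.
- by left; lia.
- by move=> j j_in; lia.
- move=> r le_rm; rewrite (_ : (n - _)%N = (p.+1 + r)%N); last by lia.
  by rewrite sgD // /theta /N k2_eq k3_eq n_eq; field.
- move=> r /subnK; move: (m - r)%N => j /esym; rewrite addnC => em.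
  rewrite (_ : (n - _ - _)%N = (q.+1 + j)%N); last by lia.
  rewrite sgD // /theta -(signr_odd C j) -(signr_odd C r) (odd_rj r j em) /N k2_eq k3_eq n_eq em.
  by case: (odd r); rewrite /= ?expr0 ?expr1; field.
- move=> r lt_r; rewrite (_ : _.+1 = q.+1 + (m - r).+1)%N; last by lia.
  by rewrite k3_eq dunkl_nat_shift_neq0.
move=> r lt_rm; have /subnK := ltnW lt_rm; move: (m - r)%N => j /esym; rewrite addnC => em.
rewrite (_ : (n - _ - _)%N = (q.+1 + j)%N); last by lia.
rewrite (_ : (n.+1 - _)%N = (p.+1 + r.+1)%N); last by lia.
rewrite k3_eq k2_eq !dunkl_nat_shift // (odd_rj r j em) /phiE /= negbK.
rewrite [(m - _ + 1)%N](_ : _ = j); last by lia.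
rewrite /N n_eq em; case: (odd r) => /=; first by rewrite natrM; ring.
by field.
Qed.

(** Both quotients of (ii) have the same window of top exponents of [x_3]: [lo = t_3] gives the one
    inside [M_n(x_3)], [lo = 0] the one of [M_n]. *)
Lemma quot_W2 lo : dn k3 lo = 0 -> (lo + p <= n)%N ->
  quot_iso (BIop k1 k2 k3) (restr_adm k1 k2 k3 n lo n)
    (restr_adm k1 k2 k3 n lo (n - p.+1))
    (dsum (twist_aut (fun=> 1) perm13 (Omod p k1 (- K - n%:R - 1) k3))).
Proof.
move=> dn_lo le_lo; pose b : C := - K - n%:R - 1.
apply: (quot_decreasing odd_n dunkl1_neq0 (d := p) (x := 1) (a := k1)
  (b := b) (phi := phiO p k1 b k3)) => //.
- by rewrite expr1n.
- by rewrite subnn dunkl_nat0.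
- rewrite /twist_aut /= scale1r /Omod /=; congr (_ - _%:M).
  by rewrite /kappaM /b /K k2_eq; field.
- by right; rewrite (_ : (n.+1 - _)%N = p.+1) ?k2_eq ?dunkl_nat_top //; lia.
- by move=> j j_in; lia.
- move=> r le_rp; rewrite subKn; last by lia.
  by rewrite /theta k2_eq; field.
- move=> r le_rp; rewrite natrB; last by lia.
  have -> : (-1) ^+ (n - r) = - (-1) ^+ r :> C.
    rewrite -signr_odd oddB ?odd_n; last by lia.
    by rewrite -[in RHS]signr_odd; case: (odd r); rewrite /= ?expr0 ?expr1 ?opprK.
  by rewrite /theta /b /K k2_eq; field.
- move=> r lt_r; rewrite (_ : _.+1 = q.+1 + (p + m + 2 - r))%N; last by lia.
  by rewrite k3_eq dunkl_nat_shift_neq0 //; lia.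
move=> r lt_rp; rewrite (_ : (n.+1 - _)%N = r.+1); last by lia.
have /subnK := ltnW lt_rp; move: (p - r)%N => j /esym; rewrite addnC => ep.
rewrite (_ : (n - r)%N = (q.+1 + (j + m).+1)%N); last by lia.
have odd_jm : odd (j + m) = ~~ odd r.
  move: odd_n even_p; rewrite n_eq ep !oddD (negPf even_q).
  by case: (odd r); case: (odd j); case: (odd m).
rewrite k3_eq dunkl_nat_shift //= odd_jm negbK /dn /phiO /= negbK /b /K k2_eq k3_eq n_eq ep.
by case: (odd r) => /=; field.
Qed.

(** Both quotients of (iii) at once: [hi = n - t_2] for [M_n(x_2)], [hi = n] for [M_n]. *)
Lemma quot_W3 hi : dn k2 (n - hi) = 0 -> (q <= hi <= n)%N ->
  quot_iso (BIop k1 k2 k3) (restr_adm k1 k2 k3 n 0 hi)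
    (restr_adm k1 k2 k3 n q.+1 hi)
    (dsum (twist_aut (fun=> 1) perm132 (Omod q k1 (- K - n%:R - 1) k2))).
Proof.
move=> dn_hi /andP[le_qhi le_hi]; pose b : C := - K - n%:R - 1.
apply: (quot_increasing odd_n dunkl1_neq0 (d := q) (x := 1) (a := k1)
  (b := b) (phi := phiO q k1 b k2)) => //.
- by rewrite expr1n.
- by rewrite dunkl_nat0.
- rewrite /twist_aut /= scale1r /Omod /=; congr (_ - _%:M).
  by rewrite /kappaM /b /K k3_eq; field.
- by rewrite k3_eq dunkl_nat_top.
- by move=> j j_in; lia.
- by move=> r le_rq; rewrite /theta k3_eq; field.
- move=> r le_rq; rewrite natrB; last by lia.
  have -> : (-1) ^+ (n - r) = - (-1) ^+ r :> C.
    rewrite -signr_odd oddB ?odd_n; last by lia.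
    by rewrite -[in RHS]signr_odd; case: (odd r); rewrite /= ?expr0 ?expr1 ?opprK.
  by rewrite /theta /b /K k3_eq; field.
- move=> r lt_r; rewrite (_ : (n.+1 - r)%N = p.+1 + (q + m + 2 - r))%N; last by lia.
  by rewrite k2_eq dunkl_nat_shift_neq0 //; lia.
move=> r lt_rq; have /subnK := ltnW lt_rq; move: (q - r)%N => j /esym; rewrite addnC => eqj.
rewrite (_ : (n - r)%N = (p.+1 + (j + m).+1)%N); last by lia.
have odd_jm : odd (j + m) = ~~ odd r.
  move: odd_n even_q; rewrite n_eq eqj !oddD (negPf even_p).
  by case: (odd r); case: (odd j); case: (odd m).
rewrite k2_eq dunkl_nat_shift //= odd_jm negbK /dn /phiO /= negbK /b /K k2_eq k3_eq n_eq eqj.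
by case: (odd r) => /=; field.
Qed.

End ParameterChecks.

(** * Assembly of the theorem *)

Lemma quot_iso_ext (C : numClosedFieldType) (V : lmodType C) (ops : 'I_3 -> V -> V)
  (A A' B B' : V -> Prop) r (W : 'I_3 -> 'M[C]_r) :
  (forall v, A v <-> A' v) -> (forall v, B v <-> B' v) ->
  quot_iso ops A B W -> quot_iso ops A' B' W.
Proof.
move=> eA eB [phi [lin surj ker hom]]; exists phi; split.
- by move=> c u v /eA Au /eA Av; apply: lin.
- by move=> w; have [v /eA Av <-] := surj w; exists v.
- by move=> v /eA Av; rewrite ker //; apply: eB.
- by move=> g v /eA Av; apply: hom.
Qed.

Theorem theorem8p7 (C : numClosedFieldType) (k1 k2 k3 : C) (n t2 t3 : nat) :
  k1 \is Num.real -> k2 \is Num.real -> k3 \is Num.real ->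
  odd n -> is_t k2 t2 -> is_t k3 t3 -> (t2 + t3 <= n)%N -> lt_t k1 n ->
  let K := k1 + k2 + k3 in
  let N := (n%:R + 1) / 2 : C in
  let ops := BIop k1 k2 k3 in
  let M := Mn k1 k2 k3 n in
  let M2 := Mnx k1 k2 k3 n i2 t2 in
  let M3 := Mnx k1 k2 k3 n i3 t3 in
  let M23 := fun v => M2 v /\ M3 v in
  let W1 := twist_aut (sgn_mm C) perm13
              (Emod (n - t2 - t3) (k1 + k3 + N) (- k1 - k2 - N) N) in
  let W2 := twist_aut (fun=> 1) perm13 (Omod t2.-1 k1 (- K - n%:R - 1) k3) in
  let W3 := twist_aut (fun=> 1) perm132 (Omod t3.-1 k1 (- K - n%:R - 1) k2) in
  [/\ quot_iso ops M23 (fun v => v = 0) (dsum W1),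
      (quot_iso ops M3 M23 (dsum W2) /\ quot_iso ops M M2 (dsum W2)),
      (quot_iso ops M2 M23 (dsum W3) /\ quot_iso ops M M3 (dsum W3))
    & 0 <= k1 ->
      [/\ irreducible W1, irreducible W2 & irreducible W3] /\
      [/\ mod_iso W1 (twist_aut (sgn_1m C) id
                        (Emod (n - t2 - t3) N (k1 + k2 + N) (k1 + k3 + N))),
          mod_iso W2 (Omod t2.-1 k3 (- K - n%:R - 1) k1)
        & mod_iso W3 (Omod t3.-1 k2 k1 (- K - n%:R - 1))]].
Proof.
move=> _ _ _ odd_n [odd2 e2] [odd3 e3].
case: t2 odd2 e2 => // p odd2 e2; case: t3 odd3 e3 => // q odd3 e3.
have even_p : ~~ odd p := odd2; have even_q : ~~ odd q := odd3.
move=> le_n lt_n K N ops M M2 M3 M23 W1 W2 W3.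
have half (k : C) t : 2 * k = - t%:R -> k = - t%:R / 2.
  by move=> <-; field.
have {e2} k2_eq := half _ _ e2; have {half e3} k3_eq := half _ _ e3.
(* A zero of this coefficient forces [a + 1] to be odd with [2 k_1 = -(a + 1)], that is
   [t_1 = a + 1 <= n]. *)
have nz1 a : (a < n)%N -> dunkl_nat k1 a.+1 != 0.
  move=> lt_an; rewrite /dunkl_nat; case: ifP => odd_a; last first.
    by rewrite addr0 pnatr_eq0.
  apply: contraTneq lt_an => e; rewrite -leqNgt -ltnS; apply: lt_n; split=> //.
  by apply/eqP; rewrite -addr_eq0 addrC e.
pose m := (n - p.+1 - q.+1)%N.
have n_eq : n = (p + q + 2 + m)%N by rewrite /m; lia.
have dn2 : dunkl_nat k2 p.+1 = 0 by rewrite k2_eq dunkl_nat_top.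
have dn3 : dunkl_nat k3 q.+1 = 0 by rewrite k3_eq dunkl_nat_top.
have eM v : restr_adm k1 k2 k3 n 0 n v <-> M v by apply: iff_sym; apply: Mn_adm.
have eM2 v : restr_adm k1 k2 k3 n 0 (n - p.+1) v <-> M2 v.
  by apply: iff_sym; apply: Mnx2_adm => //; lia.
have eM3 v : restr_adm k1 k2 k3 n q.+1 n v <-> M3 v by apply: iff_sym; apply: Mnx3_adm.
have eM23 v : restr_adm k1 k2 k3 n q.+1 (n - p.+1) v <-> M23 v.
  have [h h'] := restr_adm_meet k1 k2 k3 n v q.+1 (n - p.+1).
  split=> [/h'[/eM2 v2 /eM3 v3]|[/eM2 v2 /eM3 v3]]; first by split.
  exact: h.
have eM0 v : restr_adm k1 k2 k3 n 1 0 v <-> v = 0.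
  by apply: iff_sym; apply: restr_adm_empty.
split.
- exact: (quot_iso_ext eM23 eM0 (quot_W1 even_p even_q odd_n n_eq k2_eq k3_eq nz1)).
- have h := quot_W2 even_p even_q odd_n n_eq k2_eq k3_eq nz1.
  split; first by apply: (quot_iso_ext eM3 eM23); apply: h => //; lia.
  by apply: (quot_iso_ext eM eM2); apply: h; rewrite ?dunkl_nat0 //; lia.
- have h := quot_W3 even_p even_q odd_n n_eq k2_eq k3_eq nz1.
  split; first by apply: (quot_iso_ext eM2 eM23); apply: h; [rewrite subKn //|]; lia.
  by apply: (quot_iso_ext eM eM3); apply: h; rewrite ?subnn ?dunkl_nat0 //; lia.
move=> k1_ge0.
have odd_m : odd m.
  by move: odd_n; rewrite n_eq !oddD (negPf even_p) (negPf even_q).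
have [irr1 iso1] := Emod_twist13 k1_ge0 p q odd_m.
have [irr2 iso2] := Omod_twist13 k1_ge0 q m even_p.
have [irr3 iso3] := Omod_twist132 k1_ge0 p m even_q.
have eN : (p + q + m + 3)%:R / 2 = N :> C by rewrite /N n_eq; field.
have ea : k1 - q.+1%:R / 2 + N = k1 + k3 + N by rewrite k3_eq; field.
have eb : - k1 + p.+1%:R / 2 - N = - k1 - k2 - N by rewrite k2_eq; field.
have eb' : - (- k1 - k2 - N) = k1 + k2 + N by ring.
have ek2 : - p.+1%:R / 2 = k2 by [].
have ek3 : - q.+1%:R / 2 = k3 by [].
have eK2 : - k1 - (p + q)%:R / 2 - 2 - m%:R = - K - n%:R - 1.
  by rewrite /K k2_eq k3_eq n_eq; field.
have eK3 : - k1 - (q + p)%:R / 2 - 2 - m%:R = - K - n%:R - 1.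
  by rewrite addnC.
rewrite eN ea eb ?eb' in irr1 iso1; rewrite ek3 eK2 in irr2 iso2.
rewrite ek2 eK3 in irr3 iso3.
by split; split.
Qed.
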